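(* For every $\epsilon>0$, $$\lambda\left(\left\{x\in(0,1): \left|\frac{S_n(x)}{n\log^2 n}-\frac{1}{2\log 2}\right|\ge\epsilon\right\}\right)\to 0\quad\text{as } n\to\infty.$$
   Context: Every irrational $x\in(0,1)$ has a unique simple continued fraction expansion $x=[a_1(x),a_2(x),a_3(x),\ldots]=\cfrac{1}{a_1(x)+\cfrac{1}{a_2(x)+\cdots}}$ with positive integers $a_n(x)$ (partial quotients). For irrational $x\in(0,1)$ and $n\ge1$, $S_n(x)=\sum_{i=1}^n a_i(x)a_{i+1}(x)$. Sets of $x\in(0,1)$ defined through the partial quotients are understood to consist of irrational $x$. $\lambda$ denotes Lebesgue measure, $\log$ is the natural logarithm and $\log^2 n=(\log n)^2$. *)

(* Defs.v *)
From mathcomp Require Export all_boot all_order all_algebra.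
From mathcomp Require Export all_classical all_reals all_analysis.
From mathcomp Require Import ring lra.

Set Implicit Arguments.
Unset Strict Implicit.
Unset Printing Implicit Defensive.

Import Order.TTheory GRing.Theory Num.Theory.
Import numFieldNormedType.Exports.

Local Open Scope classical_set_scope.
Local Open Scope ring_scope.

(* The fractional part of 1 / x (intended for x > 0). *)
Definition gauss_map (R : realType) (x : R) : R :=
  x^-1 - (Num.truncn x^-1)%:R.

(* a_n(x) for n >= 1; the value at n = 0 has no meaning. That this computes
   the continued fraction expansion of x is [partial_quotientP] below. *)
Definition partial_quotient (R : realType) (x : R) (n : nat) : nat :=
  Num.truncn (iter n.-1 (@gauss_map R) x)^-1.

(* S_n(x) *)
Definition product_sum (R : realType) (n : nat) (x : R) : nat :=
  (\sum_(1 <= i < n.+1) partial_quotient x i * partial_quotient x i.+1)%N.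

(* The finite continued fraction [a_i, ..., a_(i + n - 1)]. *)
Fixpoint finite_cf (R : realType) (a : nat -> nat) (i n : nat) : R :=
  if n is n'.+1 then ((a i)%:R + finite_cf R a i.+1 n')^-1 else 0.

(* x = [a_1, a_2, a_3, ...] with positive integers a_n *)
Definition cf_expansion (R : realType) (a : nat -> nat) (x : R) : Prop :=
  (forall i : nat, (0 < i)%N -> (0 < a i)%N) /\
  finite_cf R a 1 n @[n --> \oo] --> x.

Section ContinuedFraction.
Variable R : realType.
Implicit Types (x y : R) (a : nat -> nat).

Let irr01 x := irrational x /\ 0 < x < 1.

Lemma finite_cf_ge0 a i n : 0 <= finite_cf R a i n.
Proof.
by elim: n i => [//|n IH] i /=; rewrite invr_ge0 addr_ge0.
Qed.

Lemma finite_cf_le1 a i n : (forall j, (i <= j)%N -> (0 < a j)%N) ->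
  finite_cf R a i n <= 1.
Proof.
case: n => [|n] ap //=.
have h1 : 1 <= (a i)%:R + finite_cf R a i.+1 n.
  by rewrite -[leLHS]addr0 lerD ?finite_cf_ge0// ler1n ap.
by rewrite invf_le1// (lt_le_trans ltr01).
Qed.

Lemma irrational_inv_sub x (m : nat) : irrational x ->
  irrational (x^-1 - m%:R).
Proof.
move=> ix [q _ qE]; apply: ix; exists ((q + m%:R)^-1) => //.
by rewrite fmorphV rmorphD /= qE rmorph_nat subrK invrK.
Qed.

Lemma irrational_neq_nat x (m : nat) : irrational x -> x != m%:R.
Proof.
by move=> ix; apply/eqP => xm; apply: ix; exists m%:R; rewrite ?rmorph_nat.
Qed.

Lemma gauss_map_irr01 x : irr01 x -> irr01 (gauss_map x).
Proof.
move=> [ix /andP[x0 x1]].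
have ig : irrational (gauss_map x) by exact: irrational_inv_sub.
split=> //.
have := @truncn_itv _ x^-1 (ltW _); rewrite invr_gt0 => /(_ x0)/andP[h1 h2].
have := irrational_neq_nat 0 ig; rewrite /gauss_map => g0.
apply/andP; split; last by rewrite ltrBlDl natr1.
by rewrite lt_neqAle eq_sym g0 subr_ge0.
Qed.

Lemma iter_gauss_map_irr01 x n :
  irr01 x -> irr01 (iter n (@gauss_map R) x).
Proof. by move=> ix; elim: n => //= n; exact: gauss_map_irr01. Qed.

Lemma truncn_inv_gt0 x : irr01 x -> (0 < Num.truncn x^-1)%N.
Proof.
move=> [_ /andP[x0 x1]]; rewrite truncn_gt0 /=.
by rewrite ltW// invf_gt1.
Qed.

Lemma partial_quotient_gt0 x i : irr01 x -> (0 < partial_quotient x i)%N.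
Proof. by move=> ix; apply/truncn_inv_gt0/iter_gauss_map_irr01. Qed.

Lemma gauss_mapK x : x = ((Num.truncn x^-1)%:R + gauss_map x)^-1.
Proof. by rewrite /gauss_map addrC subrK invrK. Qed.

Lemma finite_cf_error x i n k : irr01 x ->
  `|finite_cf R (partial_quotient x) i.+1 (n + k.*2)
    - iter i (@gauss_map R) x| <= 2^-1 ^+ k.
Proof.
move=> ix; elim: k i => [|k IH] i.
  rewrite expr0 addn0; have [_ /andP[t0 t1]] := iter_gauss_map_irr01 i ix.
  have c0 := finite_cf_ge0 (partial_quotient x) i.+1 n.
  have c1 : finite_cf R (partial_quotient x) i.+1 n <= 1.
    by apply: finite_cf_le1 => j _; exact: partial_quotient_gt0.
  by rewrite ler_norml; apply/andP; split; lra.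
have step (b c t : R) : 0 < b -> 0 <= c -> 0 <= t ->
    (b + c)^-1 - (b + t)^-1 = - ((b + c)^-1 * (b + t)^-1) * (c - t).
  by move=> b0 c0 t0; field; apply/andP; split; apply: lt0r_neq0; lra.
rewrite doubleS !addnS /=.
set c2 := finite_cf R _ i.+3 _; set t := iter i _ x.
have it : irr01 t by exact: iter_gauss_map_irr01.
have it1 := gauss_map_irr01 it; have it2 := gauss_map_irr01 it1.
have := IH i.+2; rewrite -/c2 /= -/t.
have c20 : 0 <= c2 by exact: finite_cf_ge0.
rewrite {2}(gauss_mapK t) {2}(gauss_mapK (gauss_map t)).
rewrite /(partial_quotient x i.+1) /(partial_quotient x i.+2) /= -/t.
have : 1 <= (Num.truncn t^-1)%:R :> R by rewrite ler1n truncn_inv_gt0.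
have : 1 <= (Num.truncn (gauss_map t)^-1)%:R :> R.
  by rewrite ler1n truncn_inv_gt0.
case: it2 => _ /andP[].
move: (Num.truncn t^-1)%:R (Num.truncn (gauss_map t)^-1)%:R.
move: (gauss_map (gauss_map t)) => s p q s0 s1 q1 p1 e.
have qc0 : 0 < q + c2 by lra.
have qs0 : 0 < q + s by lra.
have u0 : 0 < (q + c2)^-1 by rewrite invr_gt0.
have v0 : 0 < (q + s)^-1 by rewrite invr_gt0.
have p0 : 0 < p by lra.
have q0 : 0 < q by lra.
rewrite (step p _ _ p0 (ltW u0) (ltW v0)) (step q _ _ q0 c20 (ltW s0)).
rewrite mulrA normrM exprS ler_pM//.
rewrite mulrNN ger0_norm; last first.
  by rewrite !mulr_ge0 ?invr_ge0// ?addr_ge0// ltW//; lra.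
have half (u : R) : 0 < u -> u <= 1 -> (p + u)^-1 * u <= 2^-1.
  move=> u_gt0 u1; rewrite mulrC ler_pdivrMr; lra.
have v1 : (q + s)^-1 <= 1 by rewrite invf_le1//; lra.
have u1 : (q + c2)^-1 <= 1 by rewrite invf_le1//; lra.
have A : (p + (q + s)^-1)^-1 * (q + s)^-1 <= 2^-1 by exact: half.
have B : (p + (q + c2)^-1)^-1 * (q + c2)^-1 <= 1.
  by apply: (le_trans (half _ _ _)) => //; lra.
rewrite [leLHS](_ : _ = ((p + (q + c2)^-1)^-1 * (q + c2)^-1) *
  ((p + (q + s)^-1)^-1 * (q + s)^-1)); last by ring.
rewrite -[leRHS]mul1r ler_pM// mulr_ge0// ?invr_ge0 ?ltW//; lra.
Qed.

Lemma partial_quotient_expansion x : irr01 x ->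
  cf_expansion (partial_quotient x) x.
Proof.
move=> ix; split=> [i _|]; first exact: partial_quotient_gt0.
apply/cvgrPdist_le => e e0.
have : (2^-1 ^+ k : R) @[k --> \oo] --> 0.
  by apply: cvg_expr; rewrite ger0_norm; lra.
move=> /cvgrPdist_le/(_ e e0)[k _ /(_ k (leqnn k))].
rewrite sub0r normrN ger0_norm ?exprn_ge0// => ke.
exists k.*2 => //= n /= kn; rewrite distrC (le_trans _ ke)//.
by rewrite -(subnK kn); exact: (@finite_cf_error x 0).
Qed.

Lemma cf_expansion_unique x a : irr01 x -> cf_expansion a x ->
  forall i, (0 < i)%N -> a i = partial_quotient x i.
Proof.
move=> ix [a0 ax].
suff H i : finite_cf R a i.+1 n @[n --> \oo] --> iter i (@gauss_map R) x /\
    a i.+1 = partial_quotient x i.+1.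
  by case=> // i _; have [] := H i.
have H1 j : finite_cf R a j.+1 n @[n --> \oo] --> iter j (@gauss_map R) x ->
    finite_cf R a j.+2 n @[n --> \oo] --> iter j.+1 (@gauss_map R) x /\
    a j.+1 = partial_quotient x j.+1.
  rewrite /partial_quotient /=; have := iter_gauss_map_irr01 j ix.
  set t := iter j _ x => it ct; have [irt /andP[t0 t1]] := it.
  have cz : finite_cf R a j.+2 n @[n --> \oo] --> t^-1 - (a j.+1)%:R.
    have : finite_cf R a j.+1 n.+1 @[n --> \oo] --> t.
      by rewrite (cvg_shiftS (fun n => finite_cf R a j.+1 n)).
    move=> /(cvgV (lt0r_neq0 t0)) ct1.
    rewrite (_ : (fun n => _) = (fun n => (finite_cf R a j.+1 n.+1)^-1
      - (a j.+1)%:R)); first by apply: cvgB ct1 _; exact: cvg_cst.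
    by apply/funext => n /=; rewrite invrK addrC addKr.
  have iz : irrational (t^-1 - (a j.+1)%:R) by exact: irrational_inv_sub.
  have z0 : 0 <= t^-1 - (a j.+1)%:R.
    have := cvgP _ cz => /limr_ge; rewrite -(cvg_lim _ cz)//; apply.
    by near=> n; exact: finite_cf_ge0.
  have z1 : t^-1 - (a j.+1)%:R <= 1.
    have := cvgP _ cz => /limr_le; rewrite -(cvg_lim _ cz)//; apply.
    by near=> n; apply: finite_cf_le1 => m jm; apply: a0; exact: leq_trans jm.
  have z1' : t^-1 - (a j.+1)%:R < 1.
    by rewrite lt_neqAle z1 (irrational_neq_nat 1 iz).
  have tE : Num.truncn t^-1 = a j.+1.
    by apply: truncn_def; rewrite -subr_ge0 z0 -natr1 -ltrBlDl.
  by rewrite /gauss_map tE.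
suff H2 : finite_cf R a i.+1 n @[n --> \oo] --> iter i (@gauss_map R) x.
  by split=> //; have [] := H1 _ H2.
by elim: i => // i /H1[].
Unshelve. all: by end_near. Qed.

(* Existence and uniqueness of the expansion of an irrational x in (0, 1). *)
Theorem partial_quotientP x a : irrational x -> 0 < x < 1 ->
  cf_expansion a x <->
  forall i : nat, (0 < i)%N -> a i = partial_quotient x i.
Proof.
move=> ix x01; split; first exact: cf_expansion_unique.
move=> aE; have [p0 px] := partial_quotient_expansion (conj ix x01).
split=> [i i0|]; first by rewrite aE// p0.
have E i n : (0 < i)%N ->
    finite_cf R a i n = finite_cf R (partial_quotient x) i n.
  by elim: n i => //= n IH i i0; rewrite IH// aE.
by under eq_fun do rewrite E//.
Qed.

End ContinuedFraction.

(* Main.v *)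
Require Import Defs.
From mathcomp Require Import all_boot all_order all_algebra.
From mathcomp Require Import all_classical all_reals all_analysis.
From mathcomp Require Import ring lra zify.

Set Implicit Arguments.
Unset Strict Implicit.
Unset Printing Implicit Defensive.

Import Order.TTheory GRing.Theory Num.Theory.
Import numFieldNormedType.Exports.

Local Open Scope classical_set_scope.
Local Open Scope ring_scope.

(* Truncating the digits at N turns all expectations into finite sums.  For x
   uniform in (0,1) put t = q_(k-1) / q_k, where q_k are the denominators of the
   convergents; then the next digit equals a with probability
   (1 + t) / ((a + t) (a + 1 + t)), after which t becomes 1 / (a + t).  The
   Markov operator of this chain shrinks Lipschitz constants by a factor 9/10, so
   its iterates on 1 + t tend to a constant; the constant is 1 / ln 2, because
   the Gauss density 1 / (1 + t) is invariant (this is read off Riemann sums).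
   Let X_i = a_i a_(i+1) if this is at most T, and 0 otherwise.  Uniformly in t,
   E X_1 = (1 + t) ((ln T)^2 / 2 + O(ln T)), so E X_i is close to
   (ln T)^2 / (2 ln 2) for large i, and E (X_i X_j) is at most about its square
   once i and j - i are large; the other pairs contribute O(n T ln T).  With T of
   order n (ln n)^2 the event that some a_i a_(i+1) exceeds T has probability
   O(n ln T / T) = o(1), n T ln T = o(n^2 (ln n)^4), and ln T ~ ln n, so that
   Chebyshev's inequality applies. *)

(** * The digit process *)

Section DigitProcess.
Variable R : realType.
Implicit Types (t s : R) (F : R -> R) (G : seq nat -> R) (N n a : nat).

(** The products [a_i a_(i+1)] have infinite mean, so moments make sense only after the truncation
    at [T]. The truncation of the digits at [N] is a separate device: [N] is chosen last, so large
    that the mass lost to larger digits, at most [2 / N] per digit, is negligible. Dependence is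
    handled by uniformity: conditioning on a block of digits changes the law of the future only
    through the starting ratio, so an estimate valid for every ratio in [0, 1] applies after any
    past. Since [E X_1] is nearly a multiple of [1 + t], the iterates on this one function govern
    all later means. Deviations are measured from [A = n (ln n)^2 / (2 ln 2)] itself instead of from
    the mean: [E (S - A)^2 = E S^2 - 2 A E S + A^2] asks for an upper bound on the second moment and
    a lower bound on the first, and nothing two-sided. *)

Definition unit_itv t := (0 <= t) && (t <= 1).

(* The probability of the digit [a] after a past with [q_(k-1) / q_k = t]; its
   sums over [1 <= a' <= a] are [digit_cdf a t]. *)
Definition digit_prob a t : R := (1 + t) / ((a%:R + t) * (a%:R + 1 + t)).

Definition digit_cdf a t : R := a%:R / (a%:R + 1 + t).

Definition transfer N F t : R :=
  \sum_(1 <= a < N.+1) digit_prob a t * F (a%:R + t)^-1.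

(* The expectation of [G (a_1, ..., a_n)] restricted to digits at most [N]; the
   case [t = 0] is Lebesgue measure. *)
Fixpoint expect N n t G : R :=
  if n is n'.+1 then
    \sum_(1 <= a < N.+1)
      digit_prob a t * expect N n' (a%:R + t)^-1 (fun w => G (a :: w))
  else G [::].

Lemma unit_itv_inv a t : (0 < a)%N -> unit_itv t -> unit_itv (a%:R + t)^-1.
Proof.
move=> a0 /andP[t0 t1]; have a1 : 1 <= a%:R :> R by rewrite ler1n.
by rewrite /unit_itv invr_ge0 addr_ge0//= invf_le1; lra.
Qed.

Lemma digit_prob_ge0 a t : unit_itv t -> 0 <= digit_prob a t.
Proof.
move=> /andP[t0 t1]; rewrite /digit_prob divr_ge0//; first lra.
by rewrite mulr_ge0// !addr_ge0.
Qed.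

Lemma digit_probE a t : unit_itv t ->
  digit_prob a.+1 t = digit_cdf a.+1 t - digit_cdf a t.
Proof.
move=> /andP[t0 t1]; rewrite /digit_prob /digit_cdf -natr1.
have a0 : 0 <= a%:R :> R by [].
by field; apply/andP; split; apply: lt0r_neq0; lra.
Qed.

Lemma digit_cdf0 t : digit_cdf 0 t = 0.
Proof. by rewrite /digit_cdf mul0r. Qed.

Lemma sum_digit_prob m N t : (m <= N)%N -> unit_itv t ->
  \sum_(m.+1 <= a < N.+1) digit_prob a t = digit_cdf N t - digit_cdf m t.
Proof.
move=> mN ut; rewrite big_add1 /= -(telescope_sumr (digit_cdf^~ t))//.
by apply: eq_bigr => a _; rewrite digit_probE.
Qed.

Lemma digit_cdf_le1 N t : unit_itv t -> digit_cdf N t <= 1.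
Proof.
move=> /andP[t0 t1]; have N0 : 0 <= N%:R :> R by [].
by rewrite /digit_cdf ler_pdivrMr; lra.
Qed.

Lemma digit_cdf_ge N t : unit_itv t -> (0 < N)%N ->
  1 - 2 / N%:R <= digit_cdf N t.
Proof.
move=> /andP[t0 t1] N0; have N1 : 0 < N%:R :> R by rewrite ltr0n.
rewrite /digit_cdf ler_pdivlMr; last lra.
have -> : (1 - 2 / N%:R) * (N%:R + 1 + t) = N%:R + (t - 1) - 2 * (1 + t) / N%:R.
  by field; apply: lt0r_neq0.
have : 0 <= 2 * (1 + t) / N%:R by rewrite divr_ge0//; lra.
lra.
Qed.

Lemma sum_digit_prob_le1 N t : unit_itv t ->
  \sum_(1 <= a < N.+1) digit_prob a t <= 1.
Proof.
by move=> ut; rewrite sum_digit_prob// digit_cdf0 subr0 digit_cdf_le1.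
Qed.

Lemma eq_transfer N F1 F2 t : unit_itv t ->
  (forall s, unit_itv s -> F1 s = F2 s) -> transfer N F1 t = transfer N F2 t.
Proof.
move=> ut FE; apply: eq_big_nat => a /andP[a0 _].
by rewrite FE//; exact: unit_itv_inv.
Qed.

Lemma le_transfer N F1 F2 t : unit_itv t ->
  (forall s, unit_itv s -> F1 s <= F2 s) -> transfer N F1 t <= transfer N F2 t.
Proof.
move=> ut FE; apply: ler_sum_nat => a /andP[a0 _].
by rewrite ler_wpM2l ?digit_prob_ge0//; apply/FE/unit_itv_inv.
Qed.

Lemma transfer_ge0 N F t : unit_itv t ->
  (forall s, unit_itv s -> 0 <= F s) -> 0 <= transfer N F t.
Proof.
move=> ut F0; rewrite /transfer big_nat sumr_ge0// => a /andP[a0 _].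
by rewrite mulr_ge0 ?digit_prob_ge0//; apply/F0/unit_itv_inv.
Qed.

Lemma transferZ N c F t : transfer N (fun s => c * F s) t = c * transfer N F t.
Proof.
by rewrite /transfer big_distrr; apply: eq_bigr => a _; rewrite mulrCA.
Qed.

Lemma transfer_le_cst N F t c : unit_itv t -> 0 <= c ->
  (forall s, unit_itv s -> F s <= c) -> transfer N F t <= c.
Proof.
move=> ut c0 Fc.
apply: (@le_trans _ _ (transfer N (fun=> c * 1) t)).
  by apply: le_transfer => // s us; rewrite mulr1 Fc.
rewrite transferZ ler_piMr// /transfer.
by under eq_bigr do rewrite mulr1; exact: sum_digit_prob_le1.
Qed.

Lemma transfer_ge_cst N F t c : unit_itv t -> 0 <= c -> (0 < N)%N ->
  (forall s, unit_itv s -> c <= F s) -> c * (1 - 2 / N%:R) <= transfer N F t.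
Proof.
move=> ut c0 N0 Fc.
apply: (@le_trans _ _ (transfer N (fun=> c * 1) t)); last first.
  by apply: le_transfer => // s us; rewrite mulr1 Fc.
rewrite transferZ ler_wpM2l// /transfer.
under eq_bigr do rewrite mulr1.
by rewrite sum_digit_prob// digit_cdf0 subr0; exact: digit_cdf_ge.
Qed.

Lemma transfer_norm_le N F t c : unit_itv t -> 
  (forall s, unit_itv s -> `|F s| <= c) -> `|transfer N F t| <= c.
Proof.
move=> ut Fc; have c0 : 0 <= c by apply: le_trans (Fc _ ut).
apply: (@le_trans _ _ (transfer N (fun s => `|F s|) t)).
  rewrite /transfer (le_trans (ler_norm_sum _ _ _))//.
  by apply: ler_sum => a _; rewrite normrM ger0_norm ?digit_prob_ge0.
exact: transfer_le_cst.
Qed.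

Lemma eq_iter_transfer k N F1 F2 t : unit_itv t ->
  (forall s, unit_itv s -> F1 s = F2 s) ->
  iter k (transfer N) F1 t = iter k (transfer N) F2 t.
Proof.
elim: k t => [|k IH] t ut FE; [exact: FE|].
by apply: eq_transfer => // s us; exact: IH.
Qed.

Lemma le_iter_transfer k N F1 F2 t : unit_itv t ->
  (forall s, unit_itv s -> F1 s <= F2 s) ->
  iter k (transfer N) F1 t <= iter k (transfer N) F2 t.
Proof.
elim: k t => [|k IH] t ut FE; [exact: FE|].
by apply: le_transfer => // s us; exact: IH.
Qed.

Lemma iter_transferZ k N c F t :
  iter k (transfer N) (fun s => c * F s) t = c * iter k (transfer N) F t.
Proof.
elim: k t => [//|k IH] t /=; rewrite -transferZ; apply: eq_bigr => a _.
by rewrite IH.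
Qed.

Lemma iter_transfer_ge0 k N F t : unit_itv t ->
  (forall s, unit_itv s -> 0 <= F s) -> 0 <= iter k (transfer N) F t.
Proof.
elim: k t => [|k IH] t ut F0; [exact: F0|].
by apply: transfer_ge0 => // s us; exact: IH.
Qed.

Lemma iter_transfer_le_cst k N F t c : unit_itv t -> 0 <= c ->
  (forall s, unit_itv s -> F s <= c) -> iter k (transfer N) F t <= c.
Proof.
elim: k t => [|k IH] t ut c0 F0; [exact: F0|].
by apply: transfer_le_cst => // s us; exact: IH.
Qed.

Lemma iter_transfer_norm_le k N F t c : unit_itv t ->
  (forall s, unit_itv s -> `|F s| <= c) -> `|iter k (transfer N) F t| <= c.
Proof.
elim: k t => [|k IH] t ut F0; [exact: F0|].
by apply: transfer_norm_le => // s us; exact: IH.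
Qed.

(** One step loses at most the fraction [2 / N] of the mass, to the digits above [N]; Bernoulli's
    inequality turns [k] steps into the linear loss [2 k / N]. *)
Lemma iter_transfer_ge_cst k N F t c : unit_itv t -> 0 <= c -> (2 <= N)%N ->
  (forall s, unit_itv s -> c <= F s) ->
  c * (1 - 2 * k%:R / N%:R) <= iter k (transfer N) F t.
Proof.
move=> ut c0 N2 Fc; have N0 : 2 <= N%:R :> R by rewrite ler_nat.
have d1 : 2 / N%:R <= 1 :> R by rewrite ler_pdivrMr; lra.
suff H : c * (1 - 2 / N%:R) ^+ k <= iter k (transfer N) F t.
  apply: le_trans H; rewrite ler_wpM2l//.
  elim: k => [|k IH]; first by rewrite mulr0 mul0r subr0.
  rewrite exprS -(natr1 k) (le_trans _ (ler_wpM2l _ IH))//; last lra.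
  have -> : (1 - 2 / N%:R) * (1 - 2 * k%:R / N%:R) =
    1 - 2 * (k%:R + 1) / N%:R + (2 / N%:R) ^+ 2 * k%:R :> R.
    by field; apply: lt0r_neq0; lra.
  by rewrite lerDl mulr_ge0// exprn_ge0// divr_ge0.
elim: k t ut => [|k IH] t ut; first by rewrite expr0 mulr1 Fc.
rewrite exprS mulrCA mulrC.
by apply: transfer_ge_cst => //; [rewrite mulr_ge0// exprn_ge0; lra|lia].
Qed.

Lemma eq_expect N n t G1 G2 : (forall w, size w = n -> G1 w = G2 w) ->
  expect N n t G1 = expect N n t G2.
Proof.
elim: n t G1 G2 => [|n IH] t G1 G2 GE /=; first exact: GE.
by apply: eq_bigr => a _; congr (_ * _); apply: IH => w wn; rewrite GE//= wn.
Qed.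

Lemma le_expect N n t G1 G2 : unit_itv t -> (forall w, G1 w <= G2 w) ->
  expect N n t G1 <= expect N n t G2.
Proof.
elim: n t G1 G2 => [|n IH] t G1 G2 ut GE /=; first exact: GE.
apply: ler_sum_nat => a /andP[a0 _]; rewrite ler_wpM2l ?digit_prob_ge0//.
by apply: IH => [|w]; [exact: unit_itv_inv|exact: GE].
Qed.

Lemma expectD N n t G1 G2 :
  expect N n t (fun w => G1 w + G2 w) = expect N n t G1 + expect N n t G2.
Proof.
elim: n t G1 G2 => [//|n IH] t G1 G2 /=.
by rewrite -big_split /=; apply: eq_bigr => a _; rewrite IH mulrDr.
Qed.

Lemma expectZ N n t c G :
  expect N n t (fun w => c * G w) = c * expect N n t G.
Proof.
elim: n t G => [//|n IH] t G /=.
by rewrite big_distrr /=; apply: eq_bigr => a _; rewrite IH mulrCA.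
Qed.

Lemma expect0 N n t : expect N n t (fun=> 0) = 0.
Proof. by have := expectZ N n t 0 (fun=> 0); rewrite !mul0r. Qed.

Lemma expect_sum N n t (I : Type) (r : seq I) (G : I -> seq nat -> R) :
  expect N n t (fun w => \sum_(i <- r) G i w) =
  \sum_(i <- r) expect N n t (G i).
Proof.
elim: r => [|i r IH].
  rewrite big_nil -[RHS](expect0 N n t); apply: eq_expect => w _.
  exact: big_nil.
rewrite big_cons -IH -expectD; apply: eq_expect => w _; exact: big_cons.
Qed.

Lemma expect_ge0 N n t G : unit_itv t -> (forall w, 0 <= G w) ->
  0 <= expect N n t G.
Proof. by move=> ut G0; rewrite -(expect0 N n t); exact: le_expect. Qed.

Lemma expect_cst N n t c :
  expect N n t (fun=> c) = iter n (transfer N) (fun=> c) t.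
Proof. by elim: n t => [//|n IH] t /=; apply: eq_bigr => a _; rewrite IH. Qed.

(** Markov property: the first [i] digits influence the later ones only through the ratio, so
    dropping them amounts to averaging the starting ratio. *)
Lemma expect_drop N i n t G : expect N (i + n) t (fun w => G (drop i w)) =
  iter i (transfer N) (fun s => expect N n s G) t.
Proof.
elim: i t => [|i IH] t /=.
  by apply: eq_expect => w _; rewrite drop0.
by apply: eq_bigr => a _; rewrite -IH.
Qed.

Lemma expect_le_cst N n t G c : unit_itv t -> 0 <= c -> (forall w, G w <= c) ->
  expect N n t G <= c.
Proof.
move=> ut c0 Gc; apply: (le_trans (le_expect N n ut Gc)).
by rewrite expect_cst; apply: iter_transfer_le_cst.
Qed.

End DigitProcess.

(** * Contraction of Lipschitz constants by the transfer operator *)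

Section Contraction.
Variable R : realType.
Implicit Types (t x y : R) (F : R -> R) (N n a : nat).

Definition lipschitz01 M F := forall x y, unit_itv x -> unit_itv y ->
  `|F x - F y| <= M * `|x - y|.

Lemma digit_cdf_dist a x y : unit_itv x -> unit_itv y ->
  `|digit_cdf a x - digit_cdf a y| =
  a%:R / ((a%:R + 1 + x) * (a%:R + 1 + y)) * `|x - y|.
Proof.
move=> /andP[x0 x1] /andP[y0 y1]; have a0 : 0 <= a%:R :> R by [].
have -> : digit_cdf a x - digit_cdf a y =
    a%:R / ((a%:R + 1 + x) * (a%:R + 1 + y)) * (y - x).
  by rewrite /digit_cdf; field; apply/andP; split; apply: lt0r_neq0; lra.
by rewrite normrM distrC ger0_norm// divr_ge0// mulr_ge0//; lra.
Qed.

Lemma digit_cdf_lip N x y : unit_itv x -> unit_itv y ->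
  `|digit_cdf N x - digit_cdf N y| <= N%:R^-1 * `|x - y|.
Proof.
move=> ux uy; rewrite digit_cdf_dist// ler_wpM2r//.
move: ux uy => /andP[x0 x1] /andP[y0 y1].
case: N => [|N]; first by rewrite mul0r invr0.
have n0 : 0 < N.+1%:R :> R by rewrite ltr0n.
by rewrite ler_pdivrMr ?mulr_gt0//; [rewrite mulrC ler_pdivlMr//; nra|lra|lra].
Qed.

(** For [a >= 3] the weights increase with [t], so the absolute values add up to a difference of
    tail probabilities. The weight of the digit 2 is not monotone, and the digits 1 and 2 are
    estimated apart: 19/36 = 1/4 + 1/18 + 2/9, for digit 1, digit 2 and the tail. *)
Lemma digit_prob_tv N x y : (2 <= N)%N -> unit_itv x -> unit_itv y ->
  \sum_(1 <= a < N.+1) `|digit_prob a x - digit_prob a y| <= 19 / 36 * `|x - y|.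
Proof.
move=> N2; wlog xy : x y / x <= y => [H|] ux uy.
  have [xy|/ltW yx] := leP x y; first exact: H.
  by under eq_bigr do rewrite distrC; rewrite distrC; exact: H.
have [/andP[x0 x1] /andP[y0 y1]] := (ux, uy).
rewrite big_ltn; last by lia.
rewrite [X in _ + X <= _]big_ltn; last by lia.
have -> : \sum_(3 <= a < N.+1) `|digit_prob a x - digit_prob a y| =
    \sum_(3 <= a < N.+1) digit_prob a y - \sum_(3 <= a < N.+1) digit_prob a x.
  rewrite -sumrB; apply: eq_big_nat => a /andP[a3 _].
  rewrite distrC ger0_norm// subr_ge0 /digit_prob.
  have a3' : 3 <= a%:R :> R by rewrite ler_nat.
  rewrite ler_pdivrMr ?mulr_gt0//; [|lra|lra].
  rewrite mulrAC ler_pdivlMr ?mulr_gt0//; [|lra|lra].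
  rewrite -subr_ge0 (_ : _ - _ = (y - x) *
    (a%:R ^+ 2 - a%:R - 1 - x - y - x * y)); last by ring.
  by rewrite mulr_ge0; [|lra|nra].
rewrite !sum_digit_prob//.
have -> : digit_cdf N y - digit_cdf 2 y - (digit_cdf N x - digit_cdf 2 x) =
  (digit_cdf 2 x - digit_cdf 2 y) - (digit_cdf N x - digit_cdf N y) by ring.
have cN : 0 <= digit_cdf N x - digit_cdf N y.
  have n0 : 0 <= N%:R :> R by [].
  rewrite subr_ge0 /digit_cdf ler_wpM2l// lef_pV2 ?posrE; lra.
have c2 : digit_cdf 2 x - digit_cdf 2 y <= 2 / 9 * `|x - y|.
  rewrite (le_trans (ler_norm _))// digit_cdf_dist// ler_wpM2r//.
  rewrite ler_pdivrMr; nra.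
have p1 : `|digit_prob 1 x - digit_prob 1 y| <= 1 / 4 * `|x - y|.
  rewrite !digit_probE// !digit_cdf0 !subr0 digit_cdf_dist// ler_wpM2r//.
  rewrite ler_pdivrMr; nra.
have p2 : `|digit_prob 2 x - digit_prob 2 y| <= 1 / 18 * `|x - y|.
  rewrite /digit_prob.
  have -> : (1 + x) / ((2%:R + x) * (2%:R + 1 + x)) -
      (1 + y) / ((2%:R + y) * (2%:R + 1 + y)) =
    (1 - x - y - x * y) / ((2 + x) * (3 + x) * ((2 + y) * (3 + y))) * (x - y).
    by field; repeat (apply/andP; split); apply: lt0r_neq0; lra.
  rewrite normrM ler_wpM2r// normrM.
  have d36 : 36 <= (2 + x) * (3 + x) * ((2 + y) * (3 + y)).
    have dx : 6 <= (2 + x) * (3 + x) by nra.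
    have dy : 6 <= (2 + y) * (3 + y) by nra.
    nra.
  have -> : (1 : R) / 18 = 2 * 36^-1 by field.
  apply: ler_pM => //; first by rewrite ler_norml; apply/andP; split; nra.
  rewrite ger0_norm ?invr_ge0; last lra.
  by rewrite lef_pV2 ?posrE; lra.
lra.
Qed.

(** Three effects add up: the points [1 / (a + t)] move (5/8), the weights change (19/72), and the
    total truncated weight depends on [t] ([B / N]). Subtracting the value of [F] at the midpoint
    1/2 leaves at most [M / 2], which halves the 19/36 of the weights; 5/8 + 19/72 = 8/9 is below
    9/10. *)
Lemma transfer_lip N F M B : (2 <= N)%N -> lipschitz01 M F ->
  (forall t, unit_itv t -> `|F t| <= B) ->
  lipschitz01 (9 / 10 * M + B / N%:R) (transfer N F).
Proof.
move=> N2 FM FB x y ux uy.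
have uh : unit_itv (2^-1 : R) by rewrite /unit_itv; apply/andP; split; lra.
have M0 : 0 <= M.
  have u0 : unit_itv (0 : R) by rewrite /unit_itv lexx ler01.
  have u1 : unit_itv (1 : R) by rewrite /unit_itv lexx ler01.
  have := FM _ _ u1 u0; rewrite subr0 normr1 mulr1; exact: le_trans.
pose u a : R := (a%:R + x)^-1; pose v a : R := (a%:R + y)^-1.
have -> : transfer N F x - transfer N F y =
    \sum_(1 <= a < N.+1) digit_prob a y * (F (u a) - F (v a)) +
    \sum_(1 <= a < N.+1) (digit_prob a x - digit_prob a y) * (F (u a) - F 2^-1)
    + F 2^-1 * (digit_cdf N x - digit_cdf N y).
  have cE t : unit_itv t -> digit_cdf N t = \sum_(1 <= a < N.+1) digit_prob a t.
    by move=> ut; rewrite sum_digit_prob// digit_cdf0 subr0.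
  rewrite !cE// /transfer -!sumrB big_distrr/= -!big_split/=.
  by apply: eq_bigr => a _; rewrite -/(u a) -/(v a); ring.
(* The points move by at most [|x - y| / a^2]: a factor 1 for the digit 1, whose probability is at
   most 1/2, and at most 1/4 for the others; 1/2 + 1/2 * 1/4 = 5/8. *)
have S1 : `|\sum_(1 <= a < N.+1) digit_prob a y * (F (u a) - F (v a))| <=
    5 / 8 * M * `|x - y|.
  have D a : (0 < a)%N -> `|F (u a) - F (v a)| <= M * `|x - y| / a%:R ^+ 2.
    move=> a0; rewrite (le_trans (FM _ _ _ _))//; [exact: unit_itv_inv..|].
    rewrite -mulrA ler_wpM2l//.
    have a1 : 1 <= a%:R :> R by rewrite ler1n.
    move: ux uy => /andP[x0 x1] /andP[y0 y1].
    have -> : u a - v a = ((a%:R + x) * (a%:R + y))^-1 * (y - x).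
      by rewrite /u /v; field; apply/andP; split; apply: lt0r_neq0; lra.
    rewrite normrM mulrC distrC ler_wpM2l// ger0_norm; last first.
      by rewrite invr_ge0 mulr_ge0//; lra.
    rewrite lef_pV2 ?posrE ?mulr_gt0 ?exprn_gt0//; try lra.
    rewrite expr2; nra.
  rewrite big_ltn; last by lia.
  apply: (le_trans (ler_normD _ _)).
  have T1 : `|digit_prob 1 y * (F (u 1%N) - F (v 1%N))| <=
      digit_prob 1 y * (M * `|x - y|).
    rewrite normrM ger0_norm ?digit_prob_ge0// ler_wpM2l ?digit_prob_ge0//.
    by have := D 1%N isT; rewrite expr1n divr1.
  have T2 : `|\sum_(2 <= a < N.+1) digit_prob a y * (F (u a) - F (v a))| <=
      (1 - digit_cdf 1 y) * (M * `|x - y| / 4).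
    apply: (le_trans (ler_norm_sum _ _ _)).
    apply: (@le_trans _ _ (\sum_(2 <= a < N.+1)
        digit_prob a y * (M * `|x - y| / 4))); last first.
      rewrite -big_distrl/= ler_wpM2r//; first by rewrite !mulr_ge0.
      by rewrite sum_digit_prob ?(ltnW N2)// lerD2r digit_cdf_le1.
    apply: ler_sum_nat => a /andP[a2 _].
    rewrite normrM ger0_norm ?digit_prob_ge0// ler_wpM2l ?digit_prob_ge0//.
    rewrite (le_trans (D _ _)) ?(ltnW a2)// ler_wpM2l ?mulr_ge0//.
    have a2' : 2 <= a%:R :> R by rewrite ler_nat.
    by rewrite lef_pV2 ?posrE ?exprn_gt0//; [nra|lra].
  have P1 : digit_prob 1 y <= 1 / 2.
    move: uy => /andP[y0 y1]; rewrite /digit_prob ler_pdivrMr; nra.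
  have C1 : digit_cdf 1 y = digit_prob 1 y.
    by rewrite digit_probE// digit_cdf0 subr0.
  rewrite C1 in T2.
  have z0 : 0 <= M * `|x - y| by rewrite mulr_ge0.
  have : 0 <= (1 / 2 - digit_prob 1 y) * (M * `|x - y|).
    by rewrite mulr_ge0// subr_ge0.
  lra.
have S2 : `|\sum_(1 <= a < N.+1) (digit_prob a x - digit_prob a y) *
    (F (u a) - F 2^-1)| <= 19 / 72 * M * `|x - y|.
  apply: (le_trans (ler_norm_sum _ _ _)).
  apply: (@le_trans _ _ (\sum_(1 <= a < N.+1)
      `|digit_prob a x - digit_prob a y| * (M / 2))); last first.
    rewrite -big_distrl/= (le_trans (ler_wpM2r _ (digit_prob_tv N2 ux uy)))//.
      by rewrite divr_ge0.
    lra.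
  apply: ler_sum_nat => a /andP[a0 _]; rewrite normrM ler_wpM2l//.
  have ua : unit_itv (u a) by exact: unit_itv_inv.
  rewrite (le_trans (FM _ _ _ _))// ler_wpM2l//.
  by move: ua => /andP[? ?]; rewrite ler_norml; apply/andP; split; lra.
have S3 : `|F 2^-1 * (digit_cdf N x - digit_cdf N y)| <= B / N%:R * `|x - y|.
  by rewrite normrM -mulrA ler_pM ?FB// digit_cdf_lip.
apply: (le_trans (ler_normD _ _)).
apply: (le_trans (lerD (ler_normD _ _) (lexx _))).
have : 0 <= M * `|x - y| by rewrite mulr_ge0.
lra.
Qed.

(** The errors [B / N] of the single steps sum to a geometric series of ratio 9/10, whence the
    factor 10. *)
Lemma iter_transfer_lip k N F M B : (2 <= N)%N -> lipschitz01 M F ->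
  (forall t, unit_itv t -> `|F t| <= B) ->
  lipschitz01 ((9 / 10) ^+ k * M + 10 * B / N%:R) (iter k (transfer N) F).
Proof.
move=> N2 FM FB.
have u0 : unit_itv (0 : R) by rewrite /unit_itv lexx ler01.
have B0 : 0 <= B := le_trans (normr_ge0 _) (FB _ u0).
have BN : 0 <= B / N%:R by rewrite divr_ge0.
elim: k => [|k IH] x y ux uy /=.
  rewrite (le_trans (FM _ _ ux uy))// ler_wpM2r//; lra.
have FBk t : unit_itv t -> `|iter k (transfer N) F t| <= B.
  by move=> ut; exact: iter_transfer_norm_le.
rewrite (le_trans (transfer_lip N2 IH FBk ux uy))// ler_wpM2r//.
by rewrite exprS; lra.
Qed.

End Contraction.

(** * The limit of the iterates of the transfer operator *)

Section GaussConstant.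
Variable R : realType.
Implicit Types (t x y q p : R) (F : R -> R) (N n a k m : nat).

Lemma iter_transfer_sum k N (I : Type) (r : seq I) (F : I -> R -> R) t :
  iter k (transfer N) (fun s => \sum_(i <- r) F i s) t =
  \sum_(i <- r) iter k (transfer N) (F i) t.
Proof.
elim: k t => [//|k IH] t /=; rewrite exchange_big/=.
by apply: eq_bigr => a _; rewrite IH big_distrr.
Qed.

(* [pole_sum N k q p] is the [k]-th iterate of the Gauss transfer operator
   applied to [t |-> (q + t p)^-2]; its integral over [0, 1] does not depend
   on [k], up to the truncation of the digits at [N]. *)
Fixpoint pole_sum N k q p t : R :=
  if k is k'.+1 then \sum_(1 <= a < N.+1) pole_sum N k' (q * a%:R + p) q t
  else (q + t * p) ^- 2.

Lemma pole_sum_ge0 N k q p t : 0 <= pole_sum N k q p t.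
Proof.
elim: k q p => [|k IH] q p /=; first by rewrite invr_ge0 exprn_even_ge0.
by rewrite sumr_ge0.
Qed.

(** Multiplication by [1 + t] conjugates the transfer operator to the Gauss operator with weights
    [(a + t)^-2], because [(1 + s) digit_prob a t = (1 + t) (a + t)^-2] for [s = 1 / (a + t)]. The
    parameters [(q, p)] become [(q a + p, q)], the recurrence of continuants. *)
Lemma iter_transfer_pole N k q p t : 0 < q -> 0 <= p -> unit_itv t ->
  iter k (transfer N) (fun s => (1 + s) * (q + s * p) ^- 2) t =
  (1 + t) * pole_sum N k q p t.
Proof.
elim: k q p => [//|k IH] q p q0 p0 ut; rewrite iterSr /=.
rewrite (@eq_iter_transfer _ k N _ (fun s =>
  \sum_(1 <= a < N.+1) (1 + s) * ((q * a%:R + p) + s * q) ^- 2) t ut).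
  rewrite iter_transfer_sum big_distrr/=.
  apply: eq_big_nat => a /andP[a0 _]; rewrite IH// ?(ltW q0)//.
  by rewrite ltr_pwDl// mulr_gt0// ltr0n.
move=> s /andP[s0 s1]; apply: eq_big_nat => a /andP[a0 _].
have a1 : 1 <= a%:R :> R by rewrite ler1n.
have qa : 0 < q * (a%:R + s) by rewrite mulr_gt0//; lra.
rewrite /digit_prob.
field; repeat (apply/andP; split); apply: lt0r_neq0; lra.
Qed.

(* [y / (q (q + y p))] is the antiderivative of [(q + y p)^-2] vanishing at 0. *)
Lemma pole_step q p x y : 0 < q -> 0 <= p -> 0 <= x -> 0 <= y ->
  y / (q * (q + y * p)) - x / (q * (q + x * p)) =
  (y - x) / ((q + x * p) * (q + y * p)).
Proof.
move=> q0 p0 x0 y0.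
have xq : 0 <= x * p by rewrite mulr_ge0.
have yq : 0 <= y * p by rewrite mulr_ge0.
by field; repeat (apply/andP; split); apply: lt0r_neq0; lra.
Qed.

(** The terms are the integrals over [0, 1] of the functions with parameters [(q a + p, q)], so this
    is the invariance of the integral; the subtracted term belongs to the digits above [N]. *)
Lemma sum_pole_le N q p : 0 < q -> 0 <= p ->
  \sum_(1 <= a < N.+1) ((q * a%:R + p) * (q * a%:R + p + q))^-1 =
  (q * (q + p))^-1 - (q * (q * N.+1%:R + p))^-1.
Proof.
move=> q0 p0; rewrite big_add1/=.
pose f a : R := - (q * (q * a.+1%:R + p))^-1.
transitivity (f N - f 0%N); last by rewrite /f mulr1 opprK addrC.
rewrite -telescope_sumr//; apply: eq_bigr => a _; rewrite /f -!natr1.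
have a0 : 0 <= q * a%:R by rewrite mulr_ge0// ltW.
field; repeat (apply/andP; split); apply: lt0r_neq0; lra.
Qed.

(** The function decreases, so its sums at right endpoints stay below the integral, which is
    represented by telescoping values of the antiderivative. *)
Lemma pole_sum_riemann_le N k q p m : 0 < q -> 0 <= p -> (0 < m)%N ->
  \sum_(0 <= j < m) pole_sum N k q p (j.+1%:R / m%:R) / m%:R <=
  (q * (q + p))^-1.
Proof.
move=> + + m0; have m0' : 0 < m%:R :> R by rewrite ltr0n.
elim: k q p => [|k IH] q p q0 p0 /=.
  pose f j : R := (j%:R / m%:R) / (q * (q + (j%:R / m%:R) * p)).
  apply: (@le_trans _ _ (f m - f 0%N)); last first.
    by rewrite /f !mul0r subr0 divff ?lt0r_neq0// !mul1r.
  rewrite -telescope_sumr//; apply: ler_sum => j _.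
  set y := j.+1%:R / m%:R; set x := j%:R / m%:R : R.
  have x0 : 0 <= x by rewrite divr_ge0.
  have yx : y = x + m%:R^-1 by rewrite /y -natr1 mulrDl mul1r.
  have mi : 0 < m%:R^-1 :> R by rewrite invr_gt0.
  rewrite /f -/x -/y pole_step//; [|by rewrite yx; lra].
  rewrite yx [x + _ - x]addrAC subrr add0r mulrC ler_wpM2l ?(ltW mi)//.
  have xq : 0 <= x * p by rewrite mulr_ge0.
  have mq : 0 <= m%:R^-1 * p by rewrite mulr_ge0// ltW.
  by rewrite mulrDl lef_pV2 ?posrE ?exprn_gt0 ?mulr_gt0//; nra.
under eq_bigr do rewrite big_distrl/=.
rewrite exchange_big/=.
apply: (@le_trans _ _ (\sum_(1 <= a < N.+1)
    ((q * a%:R + p) * (q * a%:R + p + q))^-1)).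
  apply: ler_sum_nat => a /andP[a0 _]; apply: IH; last exact: ltW.
  by rewrite ltr_pwDl// mulr_gt0// ltr0n.
rewrite sum_pole_le// gerBl invr_ge0 mulr_ge0 ?(ltW q0)// addr_ge0//.
by rewrite mulr_ge0// ltW.
Qed.

(** Left endpoints overshoot the integral. Each level discards at most [2 / N] of the total because
    [p <= q], a relation that passes from [(q, p)] to [(q a + p, q)]. *)
Lemma pole_sum_riemann_ge N k q p m : (2 <= N)%N ->
  0 < q -> 0 <= p <= q -> (0 < m)%N ->
  (1 - 2 * k%:R / N%:R) * (q * (q + p))^-1 <=
  \sum_(0 <= j < m) pole_sum N k q p (j%:R / m%:R) / m%:R.
Proof.
move=> N2 + + m0; have m0' : 0 < m%:R :> R by rewrite ltr0n.
elim: k q p => [|k IH] q p q0 /andP[p0 pq] /=.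
  rewrite mulr0 mul0r subr0 mul1r.
  pose f j : R := (j%:R / m%:R) / (q * (q + (j%:R / m%:R) * p)).
  apply: (@le_trans _ _ (f m - f 0%N)).
    by rewrite /f !mul0r subr0 divff ?lt0r_neq0// !mul1r.
  rewrite -telescope_sumr//; apply: ler_sum => j _.
  set x := j%:R / m%:R : R.
  have x0 : 0 <= x by rewrite divr_ge0.
  have yx : j.+1%:R / m%:R = x + m%:R^-1 by rewrite -natr1 mulrDl mul1r.
  have mi : 0 < m%:R^-1 :> R by rewrite invr_gt0.
  rewrite /f -/x yx pole_step//; [|lra].
  rewrite [x + _ - x]addrAC subrr add0r [leRHS]mulrC ler_wpM2l ?(ltW mi)//.
  have xq : 0 <= x * p by rewrite mulr_ge0.
  have mq : 0 <= m%:R^-1 * p by rewrite mulr_ge0// ltW.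
  by rewrite mulrDl lef_pV2 ?posrE ?exprn_gt0 ?mulr_gt0//; nra.
under eq_bigr do rewrite big_distrl/=.
rewrite exchange_big/=.
have N0 : 2 <= N%:R :> R by rewrite ler_nat.
have [d0|d0] := leP (1 - 2 * k.+1%:R / N%:R : R) 0.
  apply: (@le_trans _ _ 0).
    by rewrite mulr_le0_ge0// invr_ge0 mulr_ge0//; lra.
  rewrite sumr_ge0// => a _; rewrite sumr_ge0// => j _; rewrite divr_ge0//.
  exact: pole_sum_ge0.
apply: (@le_trans _ _ (\sum_(1 <= a < N.+1) (1 - 2 * k%:R / N%:R) *
    ((q * a%:R + p) * (q * a%:R + p + q))^-1)); last first.
  apply: ler_sum_nat => a /andP[a0 _].
  have a1 : 1 <= a%:R :> R by rewrite ler1n.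
  apply: IH; first by rewrite ltr_pwDl// mulr_gt0// ltr0n.
  by rewrite ltW//= -[leLHS]mulr1 ler_wpDr// ler_wpM2l// ltW.
rewrite -big_distrr/= sum_pole_le// -(natr1 N).
have kN : 0 <= k%:R / N%:R :> R by rewrite divr_ge0.
have dE : 1 - 2 * k.+1%:R / N%:R = 1 - 2 * k%:R / N%:R - 2 / N%:R :> R.
  by rewrite -(natr1 k); field; apply: lt0r_neq0; lra.
set d := 1 - 2 * k%:R / N%:R in dE *.
have dn1 : d <= 1 by rewrite /d gerBl -mulrA mulr_ge0.
have Nq : 0 <= q * N%:R by rewrite mulr_ge0 ?ltW//; lra.
have E : (q * (q * (N%:R + 1) + p))^-1 <= 2 / N%:R * (q * (q + p))^-1.
  have -> : 2 / N%:R * (q * (q + p))^-1 = (q * (N%:R * (q + p) / 2))^-1.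
    by field; repeat (apply/andP; split); apply: lt0r_neq0; lra.
  have Np : 0 <= N%:R * (q - p) by rewrite mulr_ge0//; lra.
  rewrite lef_pV2 ?posrE ?mulr_gt0 ?divr_gt0//; [|lra..].
  rewrite ler_wpM2l//; [lra|].
  have Nq2 : 0 <= N%:R * p by rewrite mulr_ge0//; lra.
  lra.
have i0 : 0 <= (q * (q + p))^-1 by rewrite invr_ge0 mulr_ge0//; lra.
have i1 : 0 <= (q * (q * (N%:R + 1) + p))^-1.
  by rewrite invr_ge0 mulr_ge0//; lra.
have iE : (1 - d) * (q * (q * (N%:R + 1) + p))^-1 >= 0.
  by rewrite mulr_ge0//; lra.
rewrite dE; lra.
Qed.

Lemma ln_ratio_le x : 0 < x -> ln ((x + 1) / x) <= x^-1.
Proof.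
move=> x0; rewrite mulrDl divff ?lt0r_neq0// mul1r.
by apply: le_ln1Dx; rewrite (lt_trans _ (_ : 0 < _)) ?invr_gt0//; lra.
Qed.

Lemma ln_ratio_ge x : 0 < x -> (x + 1)^-1 <= ln ((x + 1) / x).
Proof.
move=> x0; have x1 : 0 < x + 1 by lra.
rewrite -[_ / _]invrK lnV ?posrE ?invr_gt0 ?divr_gt0//.
rewrite lerNr invf_div (_ : x / (x + 1) = 1 + - (x + 1)^-1).
  by apply: le_ln1Dx; rewrite ltrN2 invf_lt1; lra.
by field; apply: lt0r_neq0.
Qed.

(** These are the left Riemann sums with [m] nodes of [1 / (1 + t)] over [0, 1], the source of the
    constant [ln 2]. *)
Lemma sum_inv_ln m : (0 < m)%N ->
  ln 2 <= (\sum_(0 <= j < m) (m + j)%:R^-1 : R) <= ln 2 + m%:R^-1.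
Proof.
move=> m0; have m0' : 0 < m%:R :> R by rewrite ltr0n.
have L : ln 2 = \sum_(0 <= j < m) ln (((m + j)%:R + 1) / (m + j)%:R) :> R.
  pose f j : R := ln (m + j)%:R.
  rewrite (eq_big_nat _ _ (F2 := fun j => f j.+1 - f j)).
    rewrite telescope_sumr// /f addn0 addnn -mul2n natrM lnM ?posrE//.
    by rewrite addrK.
  move=> j _; rewrite ln_div ?posrE ?ltr_pwDr// ?ltr0n ?addn_gt0 ?m0//.
  by rewrite /f addnS natr1.
have p j : 0 < (m + j)%:R :> R by rewrite ltr0n addn_gt0 m0.
apply/andP; split.
  by rewrite L; apply: ler_sum => j _; exact: ln_ratio_le.
have : \sum_(0 <= j < m) (m + j.+1)%:R^-1 <= ln 2 :> R.
  by rewrite L; apply: ler_sum => j _; rewrite addnS -natr1 ln_ratio_ge.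
pose g j : R := (m + j)%:R^-1.
have := telescope_sumr g (leq0n m); rewrite sumrB /g addn0.
have : 0 <= (m + m)%:R^-1 :> R by rewrite invr_ge0.
lra.
Qed.

Lemma ln2_le1 : ln 2 <= 1 :> R.
Proof. by have := @ln_ratio_le 1 ltr01; rewrite invr1 mulr1. Qed.

Lemma ln2_ge : 1 / 2 <= ln 2 :> R.
Proof.
by have := @ln_ratio_ge 1 ltr01; rewrite divr1 (_ : (1 + 1 : R) = 2)// mul1r.
Qed.

(** With [q = 1] and [p = 0], [W s / (1 + s)] is the [K]-th Gauss iterate of the constant 1, so its
    integral is nearly 1. By contraction [W] stays within [eta] of [W 0], which makes the same
    integral nearly [W 0 ln 2]. Both integrals are Riemann sums with [N] nodes. *)
Lemma iter_transfer_cvg K N t : (2 <= N)%N -> unit_itv t ->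
  `|ln 2 * iter K (transfer N) (fun s => 1 + s) t - 1| <=
  3 * (9 / 10) ^+ K + (62 + 2 * K%:R) / N%:R.
Proof.
move=> N2 ut; set W := iter K (transfer N) _.
have N0 : 2 <= N%:R :> R by rewrite ler_nat.
have u0 : unit_itv (0 : R) by rewrite /unit_itv lexx ler01.
have WE s : unit_itv s -> W s = (1 + s) * pole_sum N K 1 0 s.
  move=> us; rewrite -iter_transfer_pole//.
  by apply: eq_iter_transfer => // r _; rewrite mulr0 addr0 expr1n invr1 mulr1.
have f_lip : lipschitz01 1 (fun s : R => 1 + s).
  by move=> x y ux uy; rewrite mul1r opprD addrACA subrr add0r.
have f_bnd (s : R) : unit_itv s -> `|1 + s| <= 2.
  by move=> /andP[s0 s1]; rewrite ler_norml; apply/andP; split; lra.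
set eta : R := (9 / 10) ^+ K + 20 / N%:R.
have Wosc s : unit_itv s -> `|W s - W 0| <= eta.
  move=> us; have /le_trans := iter_transfer_lip K N2 f_lip f_bnd us u0; apply.
  rewrite /eta mulr1 (_ : 10 * 2 = 20 :> R); last by lra.
  apply: ler_piMr; first by rewrite addr_ge0 ?exprn_ge0 ?divr_ge0//; lra.
  by case/andP: us => ? ?; rewrite subr0 ger0_norm.
have W2 : W 0 <= 2.
  apply: iter_transfer_le_cst => // s us.
  by rewrite (le_trans (ler_norm _)) ?f_bnd.
have W00 : 0 <= W 0.
  by apply: iter_transfer_ge0 => // s /andP[? ?]; lra.
have eta0 : 0 <= eta by apply: le_trans (Wosc _ u0).
have Ninv : 0 < N%:R^-1 :> R by rewrite invr_gt0; lra.
have up : ln 2 * W 0 <= 1 + eta + 2 / N%:R.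
  (* A lower bound on the Riemann sum is going to be multiplied by [W 0 - eta], which must be
     nonnegative; in the other case [ln 2 <= 1] gives the claim at once. *)
  have [Wl|Wg] := leP (W 0) eta.
    have := ln2_le1; have := ln2_ge; rewrite mulrC.
    have : 0 <= 2 / N%:R :> R by rewrite divr_ge0; lra.
    nra.
  have := @pole_sum_riemann_le N K 1 0 N ltr01 (lexx _) (ltnW N2).
  rewrite addr0 mulr1 invr1.
  have /andP[S1 S2] := sum_inv_ln (ltnW N2).
  have H : (W 0 - eta) * \sum_(0 <= j < N) (N + j.+1)%:R^-1 <=
      \sum_(0 <= j < N) pole_sum N K 1 0 (j.+1%:R / N%:R) / N%:R.
    rewrite big_distrr/=; apply: ler_sum_nat => j /andP[_ jN].
    have us : unit_itv (j.+1%:R / N%:R : R).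
      by rewrite /unit_itv divr_ge0//= ler_pdivrMr ?mul1r ?ler_nat//; lra.
    set s := j.+1%:R / N%:R in us *; have /andP[s0 s1] := us.
    have -> : (N + j.+1)%:R = (1 + s) * N%:R :> R.
      by rewrite mulrDl mul1r /s divfK ?natrD//; apply: lt0r_neq0; lra.
    rewrite invfM.
    rewrite mulrA ler_wpM2r ?(ltW Ninv)//.
    rewrite ler_pdivrMr; last lra.
    rewrite [leRHS]mulrC -WE//.
    have := Wosc _ us; rewrite ler_norml => /andP[]; lra.
  have sh : \sum_(0 <= j < N) (N + j.+1)%:R^-1 >=
      \sum_(0 <= j < N) (N + j)%:R^-1 - N%:R^-1 :> R.
    have := telescope_sumr (fun j => (N + j)%:R^-1 : R) (leq0n N).
    rewrite sumrB addn0.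
    have : 0 <= (N + N)%:R^-1 :> R by rewrite invr_ge0.
    lra.
  move=> H2; have {}H := le_trans H H2.
  have : (W 0 - eta) * (ln 2 - N%:R^-1) <= 1.
    by apply: le_trans H; rewrite ler_wpM2l//; lra.
  have := ln2_le1; have := ln2_ge.
  nra.
have lo : 1 - eta - (2 + 2 * K%:R + 1) / N%:R <= ln 2 * W 0 + eta / N%:R.
  have := @pole_sum_riemann_ge N K 1 0 N N2 ltr01 _ (ltnW N2).
  rewrite lexx ler01 => /(_ isT); rewrite addr0 mulr1 invr1 mulr1.
  have /andP[S1 S2] := sum_inv_ln (ltnW N2).
  have H : \sum_(0 <= j < N) pole_sum N K 1 0 (j%:R / N%:R) / N%:R <=
      (W 0 + eta) * \sum_(0 <= j < N) (N + j)%:R^-1.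
    rewrite big_distrr/=; apply: ler_sum_nat => j /andP[_ jN].
    have us : unit_itv (j%:R / N%:R : R).
      rewrite /unit_itv divr_ge0//= ler_pdivrMr ?mul1r ?ler_nat//; [lia|lra].
    set s := j%:R / N%:R in us *; have /andP[s0 s1] := us.
    have -> : (N + j)%:R = (1 + s) * N%:R :> R.
      by rewrite mulrDl mul1r /s divfK ?natrD//; apply: lt0r_neq0; lra.
    rewrite invfM.
    rewrite mulrA ler_wpM2r ?(ltW Ninv)//.
    rewrite ler_pdivlMr; last lra.
    rewrite mulrC -WE//.
    have := Wosc _ us; rewrite ler_norml => /andP[]; lra.
  move=> H2; have {}H := le_trans H2 H.
  have H3 : 1 - 2 * K%:R / N%:R <= (W 0 + eta) * (ln 2 + N%:R^-1).
    by apply: le_trans H _; rewrite ler_wpM2l//; lra.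
  have := ln2_le1; have := ln2_ge.
  nra.
have := Wosc _ ut; rewrite !ler_norml => /andP[w1 w2].
have := ln2_le1; have := ln2_ge.
move=> l1 l2.
have K0 : 0 <= K%:R / N%:R :> R by rewrite divr_ge0.
have E0 : 0 <= (9 / 10) ^+ K :> R by rewrite exprn_ge0//; lra.
have A1 : ln 2 * (W t - W 0) <= eta by nra.
have A2 : - eta <= ln 2 * (W t - W 0) by nra.
have A3 : eta / N%:R <= eta / 2 by rewrite ler_wpM2l// lef_pV2 ?posrE//; lra.
rewrite /eta in up lo A1 A2 A3.
apply/andP; split; lra.
Qed.

End GaussConstant.

(** * Covering by cylinders *)

Section OuterMeasure.
Variable R : realType.
Local Notation mu := (@lebesgue_measure R).
Implicit Types (A B : set R).

(** [lebesgue_measure] unfolds to an outer measure, so monotonicity and subadditivity hold for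
    arbitrary sets. *)
Lemma le_lebesgue A B : A `<=` B -> (mu A <= mu B)%E.
Proof.
move=> AB.
rewrite /lebesgue_measure /lebesgue_stieltjes_measure /measure_extension.
exact: le_outer_measure.
Qed.

Lemma lebesgueU2 A B : (mu (A `|` B) <= mu A + mu B)%E.
Proof.
rewrite /lebesgue_measure /lebesgue_stieltjes_measure /measure_extension.
exact: outer_measureU2.
Qed.

Lemma lebesgue_bigsetU (A : nat -> set R) m n :
  (mu (\big[setU/set0]_(m <= a < n) A a) <= \sum_(m <= a < n) mu (A a))%E.
Proof.
elim/big_ind2 : _ => //; first by rewrite measure0.
by move=> X x Y y Xx Yy; apply: le_trans (lebesgueU2 _ _) _; exact: leeD.
Qed.

Lemma lebesgue_segment (a b : R) : a <= b -> mu `[a, b] = (b - a)%:E.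
Proof.
move=> ab; rewrite lebesgue_measure_itv/= lte_fin; case: ltP => // ba.
have -> : a = b by lra.
by rewrite subrr.
Qed.

End OuterMeasure.

(** * Lengths of cylinders and the comparison of Lebesgue measure with [expect] *)

Section Cover.
Variable R : realType.
Local Notation mu := (@lebesgue_measure R).
Implicit Types (p r q s x y : R) (N n a : nat) (G : seq nat -> R).

Fixpoint digits n x : seq nat :=
  if n is n'.+1 then Num.truncn x^-1 :: digits n' (gauss_map x) else [::].

Lemma nth_digits n x i : (i < n)%N ->
  nth 0%N (digits n x) i = partial_quotient x i.+1.
Proof.
elim: n x i => // n IH x [|i] //= ni; rewrite IH//.
by rewrite /partial_quotient/= -iterS iterSr.
Qed.

(** The inverse branch of an iterate of the Gauss map: if [p / q] and [r / s] are the convergents of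
    orders [k] and [k - 1], it sends the [k]-th iterate of a point back to the point. *)
Definition mobius p r q s x := (p + x * r) / (q + x * s).

(** The determinant condition makes the branch equal to [p / q] plus or minus [y / (q (q + y s))],
    which is monotone in [y], so the image lies in an interval of the stated length. *)
Lemma mobius_image_le p r q s (b : R) : 0 < q -> 0 <= s -> 0 <= b ->
  `|p * s - r * q| = 1 ->
  (mu (mobius p r q s @` [set y : R | (0 <= y <= b)%R]) <=
   (b / (q * (q + b * s)))%:E)%E.
Proof.
move=> q0 s0 b0 det.
pose d := r * q - p * s.
pose l y := y / (q * (q + y * s)).
have mE (y : R) : 0 <= y -> mobius p r q s y = p / q + d * l y.
  move=> y0; have ys : 0 <= y * s by rewrite mulr_ge0.
  by rewrite /mobius /l /d; field; apply/andP; split; apply: lt0r_neq0; lra.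
have l0 (y : R) : 0 <= y -> 0 <= l y.
  move=> y0; have ys : 0 <= y * s by rewrite mulr_ge0.
  by rewrite /l divr_ge0// mulr_ge0//; lra.
have lb (y : R) : 0 <= y -> y <= b -> l y <= l b.
  move=> y0 yb; have ys : 0 <= y * s by rewrite mulr_ge0.
  have bs : 0 <= b * s by rewrite mulr_ge0.
  rewrite /l ler_pdivrMr ?mulr_gt0//; last lra.
  rewrite mulrAC ler_pdivlMr ?mulr_gt0//; last lra.
  have : 0 <= (b - y) * (q * q) by rewrite mulr_ge0 ?mulr_ge0//; lra.
  lra.
have [dE|dE] : d = 1 \/ d = -1.
  have : `|d| = 1 by rewrite /d distrC.
  by move/eqP; rewrite eqr_norml => /andP[/orP[]/eqP]; [left|right].
- apply: (@le_trans _ _ (mu `[p / q, p / q + l b])); last first.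
    by rewrite lebesgue_segment ?lerDl ?l0// addrAC subrr add0r.
  apply: le_lebesgue => _ [y /= /andP[y0 yb] <-].
  by rewrite in_itv/= mE// dE mul1r lerDl l0// lerD2l lb.
- apply: (@le_trans _ _ (mu `[p / q - l b, p / q])); last first.
    by rewrite lebesgue_segment ?gerBl ?l0// opprB addrC subrK.
  apply: le_lebesgue => _ [y /= /andP[y0 yb] <-].
  by rewrite in_itv/= mE// dE mulN1r gerBl l0// lerD2l lerN2 lb.
Qed.

(* The measure is used as an outer measure on all sets, and the set is covered by
   the cylinders of its admissible words; [2 / N] per digit pays for the digits
   larger than [N]. *)
Lemma mobius_cover N n p r q s G : (0 < N)%N -> 0 < q -> 0 <= s <= q ->
  `|p * s - r * q| = 1 -> (forall w, 0 <= G w) ->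
  (mu (mobius p r q s @`
        [set y : R | [/\ irrational y, (0 < y < 1)%R &
          (1 <= G (digits n y))%R]]) <=
   ((expect N n (s / q) G + n%:R * (2 / N%:R)) / (q * (q + s)))%:E)%E.
Proof.
move=> N0; elim: n p r q s G => [|n IH] p r q s G q0 /andP[s0 sq] det G0.
  have [G1|G1] := leP 1 (G [::]); last first.
    rewrite (_ : [set y | _] = set0) ?image_set0 ?measure0 ?lee_fin.
      by rewrite divr_ge0 ?mul0r ?addr0//= mulr_ge0//; lra.
    by apply/seteqP; split => // y /= [_ _]; lra.
  apply: (@le_trans _ _ (mu (mobius p r q s @` [set y : R | (0 <= y <= 1)%R]))).
    apply: le_lebesgue; apply: image_subset => y /= [_ /andP[y0 y1] _].
    by rewrite !ltW.
  apply: (le_trans (mobius_image_le q0 s0 ler01 det)).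
  rewrite lee_fin !mul1r mul0r addr0 ler_peMl// invr_ge0 mulr_ge0//; lra.
have N0' : 1 <= N%:R :> R by rewrite ler1n.
set A := [set y | _].
pose Aa a := [set y : R | [/\ irrational y, (0 < y < 1)%R &
  (1 <= G (a :: digits n y))%R]].
pose Ca a := mobius (p * a%:R + r) p (q * a%:R + s) q @` Aa a.
have sub : mobius p r q s @` A `<=`
    (\big[setU/set0]_(1 <= a < N.+1) Ca a) `|`
    mobius p r q s @` [set y : R | (0 <= y <= N.+1%:R^-1)%R].
  move=> _ [y /= [iy y01 Gy] <-]; have [y0 y1] := andP y01.
  have yi0 : 0 <= y^-1 by rewrite invr_ge0 ltW.
  have [aN|Na] := leqP (Num.truncn y^-1) N; last first.
    right; exists y => //=; rewrite ltW//=.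
    rewrite -[y]invrK lef_pV2 ?posrE ?invr_gt0//.
    have /andP[h _] := truncn_itv yi0; apply: le_trans h.
    by rewrite ler_nat.
  left; set a := Num.truncn y^-1 in aN.
  have a0 : (0 < a)%N by exact: (truncn_inv_gt0 (conj iy y01)).
  have [ig g01] := gauss_map_irr01 (conj iy y01).
  suff : Ca a (mobius p r q s y).
    move=> Cy; rewrite -bigcup_seq; exists a => //=.
    by rewrite mem_index_iota a0 ltnS.
  exists (gauss_map y); first by split.
  have aE : y = (a%:R + gauss_map y)^-1 by exact: gauss_mapK.
  have a1 : 1 <= a%:R :> R by rewrite ler1n.
  move: aE g01; move: (gauss_map y) => g aE /andP[g0 g1].
  rewrite /mobius aE.
  have qa : 0 < q * (a%:R + g) by rewrite mulr_gt0//; lra.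
  field; repeat (apply/andP; split); apply: lt0r_neq0; lra.
apply: (le_trans (le_lebesgue sub)).
apply: (le_trans (lebesgueU2 _ _)).
have T : (mu (mobius p r q s @` [set y : R | (0 <= y <= N.+1%:R^-1)%R]) <=
    (2 / N%:R / (q * (q + s)))%:E)%E.
  have Ni : 0 <= N.+1%:R^-1 :> R by rewrite invr_ge0.
  apply: (le_trans (mobius_image_le q0 s0 Ni det)).
  rewrite lee_fin.
  have -> : N.+1%:R^-1 / (q * (q + N.+1%:R^-1 * s)) =
    (q * (q * (N%:R + 1) + s))^-1.
    rewrite -natr1; field; repeat (apply/andP; split); apply: lt0r_neq0; nra.
  have -> : 2 / N%:R / (q * (q + s)) = (q * (N%:R * (q + s) / 2))^-1.
    by field; repeat (apply/andP; split); apply: lt0r_neq0; lra.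
  have Nq : 0 <= N%:R * (q - s) by rewrite mulr_ge0//; lra.
  have Nq2 : 0 <= N%:R * s by rewrite mulr_ge0//; lra.
  rewrite lef_pV2 ?posrE ?mulr_gt0 ?divr_gt0//; [|nra..].
  rewrite ler_wpM2l//; lra.
have C : (mu (\big[setU/set0]_(1 <= a < N.+1) Ca a) <=
    (\sum_(1 <= a < N.+1) digit_prob a (s / q) *
      (expect N n (a%:R + s / q)^-1 (fun w => G (a :: w)) + n%:R * (2 / N%:R))
      / (q * (q + s)))%:E)%E.
  apply: (le_trans (lebesgue_bigsetU _ _ _)).
  rewrite -sumEFin big_nat [leRHS]big_nat; apply: lee_sum => a /andP[a0 _].
  have a1 : 1 <= a%:R :> R by rewrite ler1n.
  have qa : q <= q * a%:R by rewrite -[leLHS]mulr1 ler_wpM2l// ltW.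
  have qas : 0 < q * a%:R + s by lra.
  have sqa : 0 <= q <= q * a%:R + s by apply/andP; split; lra.
  have deta : `|(p * a%:R + r) * q - p * (q * a%:R + s)| = 1.
    by rewrite -det distrC; congr (`|_|); ring.
  have := IH _ _ _ _ (fun w => G (a :: w)) qas sqa deta (fun w => G0 _).
  move=> /le_trans; apply.
  have -> : q / (q * a%:R + s) = (a%:R + s / q)^-1.
    by field; apply/andP; split; apply: lt0r_neq0; lra.
  (* With [q' = q a + s], the length [1 / (q' (q' + q))] of the subcylinder is
     [digit_prob a (s / q)] times the length [1 / (q (q + s))] of the cylinder; this is the origin
     of [digit_prob]. *)
  rewrite lee_fin le_eqVlt; apply/orP; left; apply/eqP.
  rewrite /digit_prob; move: (expect _ _ _ _ + _) => e.
  by field; repeat (apply/andP; split); apply: lt0r_neq0; lra.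
apply: (le_trans (leeD C T)).
rewrite -EFinD lee_fin -mulr_suml -mulrDl ler_wpM2r//.
  by rewrite invr_ge0 mulr_ge0//; lra.
under eq_bigr do rewrite mulrDr.
rewrite big_split/= -mulr_suml.
have us : unit_itv (s / q).
  by rewrite /unit_itv divr_ge0 ?(ltW q0)//= ler_pdivrMr ?mul1r.
have := ler_wpM2r (_ : 0 <= n%:R * (2 / N%:R)) (sum_digit_prob_le1 N us).
rewrite mul1r mulr_ge0 ?divr_ge0// => /(_ isT).
by rewrite -(natr1 n); lra.
Qed.

Lemma lebesgue_digits_le N n G : (0 < N)%N -> (forall w, 0 <= G w) ->
  (mu [set y : R | [/\ irrational y, (0 < y < 1)%R &
          (1 <= G (digits n y))%R]] <=
   (expect N n 0 G + n%:R * (2 / N%:R))%:E)%E.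
Proof.
move=> N0 G0.
have := @mobius_cover N n 0 1 1 0 G N0 ltr01.
rewrite lexx ler01 mul0r mul1r sub0r normrN1 => /(_ isT erefl G0).
rewrite mul0r addr0 mulr1 divr1; apply: le_trans.
apply: le_lebesgue => y Hy; exists y => //.
by rewrite /mobius mulr0 addr0 mulr1 add0r divr1.
Qed.

End Cover.

(** * Moments of a truncated product *)

Section HarmonicSums.
Variable R : realType.
Implicit Types (N T a b c m n : nat).

Definition harmonic_sum m : R := \sum_(1 <= b < m.+1) b%:R^-1.

Lemma ln_succ_le c : (0 < c)%N -> ln c.+1%:R - ln c%:R <= c%:R^-1 :> R.
Proof.
move=> c0; rewrite -ln_div ?posrE ?ltr0n// -natr1.
by apply: ln_ratio_le; rewrite ltr0n.
Qed.

Lemma ln_succ_ge c : (0 < c)%N -> c.+1%:R^-1 <= ln c.+1%:R - ln c%:R :> R.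
Proof.
move=> c0; rewrite -ln_div ?posrE ?ltr0n// -natr1.
by apply: ln_ratio_ge; rewrite ltr0n.
Qed.

Lemma ln_nat_ge0 m : 0 <= ln m%:R :> R.
Proof. by case: m => [|m]; [rewrite ln0|rewrite ln_ge0// ler1n]. Qed.

Lemma ler_ln_nat m n : (0 < m)%N -> (m <= n)%N -> ln m%:R <= ln n%:R :> R.
Proof.
by move=> m0 mn; rewrite ler_ln ?posrE ?ler_nat ?ltr0n//; exact: leq_trans mn.
Qed.

Lemma harmonic_sum_ge m : ln m.+1%:R <= harmonic_sum m.
Proof.
have : \sum_(1 <= c < m.+1) (ln c.+1%:R - ln c%:R) <= harmonic_sum m.
  by apply: ler_sum_nat => c /andP[c0 _]; exact: ln_succ_le.
by rewrite (telescope_sumr (fun c => ln c%:R))// ln1 subr0.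
Qed.

Lemma harmonic_sum_le m : harmonic_sum m <= 1 + ln m%:R.
Proof.
case: m => [|m].
  by rewrite /harmonic_sum big_geq// addr_ge0// ln_nat_ge0.
rewrite /harmonic_sum big_ltn// invr1 lerD2l big_add1/=.
have : \sum_(1 <= c < m.+1) c.+1%:R^-1 <=
    \sum_(1 <= c < m.+1) (ln c.+1%:R - ln c%:R) :> R.
  by apply: ler_sum_nat => c /andP[c0 _]; exact: ln_succ_ge.
by rewrite (telescope_sumr (fun c => ln c%:R))// ln1 subr0.
Qed.

Lemma sum_inv_sqr_le m : \sum_(1 <= b < m.+1) b%:R ^- 2 <= 2 :> R.
Proof.
apply: (@le_trans _ _ (\sum_(1 <= b < m.+1)
    ((- 2 / b.+1%:R) - (- 2 / b%:R)))); last first.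
  rewrite (telescope_sumr (fun b => - 2 / b%:R))// divr1 opprK gerDr.
  by rewrite mulNr oppr_le0 divr_ge0.
apply: ler_sum_nat => b /andP[b0 _]; have b1 : 1 <= b%:R :> R by rewrite ler1n.
rewrite -natr1 [leRHS](_ : _ = (b%:R * (b%:R + 1) / 2)^-1); last first.
  by field; repeat (apply/andP; split); apply: lt0r_neq0; lra.
by rewrite lef_pV2 ?posrE ?exprn_gt0 ?divr_gt0 ?mulr_gt0//; nra.
Qed.

Lemma ln_divn_le T a : (0 < a <= T)%N ->
  ln (T %/ a)%:R <= ln T%:R - ln a%:R :> R.
Proof.
move=> /andP[a0 aT]; rewrite -ln_div ?posrE ?ltr0n//; last exact: leq_trans aT.
rewrite ler_ln ?posrE ?divr_gt0 ?ltr0n ?divn_gt0//; last exact: leq_trans aT.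
by rewrite ler_pdivlMr ?ltr0n// -natrM ler_nat leq_divM.
Qed.

Lemma ln_divn_ge T a : (0 < a <= T)%N ->
  ln T%:R - ln a%:R <= ln (T %/ a).+1%:R :> R.
Proof.
move=> /andP[a0 aT]; have T0 : (0 < T)%N by exact: leq_trans aT.
rewrite -ln_div ?posrE ?ltr0n// ler_ln ?posrE ?divr_gt0 ?ltr0n//.
by rewrite ler_pdivrMr ?ltr0n// -natrM ler_nat ltnW// ltn_ceil.
Qed.

(** The main term of [E X_1 / (1 + t)]: a pair of digits has value [a b] and probability about
    [(1 + t) / (a b)^2]. *)
Definition hyperbola_sum T : R :=
  \sum_(1 <= a < T.+1) \sum_(1 <= b < (T %/ a).+1) (a%:R * b%:R)^-1.

Lemma hyperbola_sumE T : hyperbola_sum T =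
  \sum_(1 <= a < T.+1) a%:R^-1 * harmonic_sum (T %/ a).
Proof.
apply: eq_bigr => a _; rewrite big_distrr/=; apply: eq_bigr => b _.
by rewrite invfM.
Qed.

Lemma hyperbola_sum_le T : (0 < T)%N ->
  hyperbola_sum T <= ln T%:R ^+ 2 / 2 + 2 * ln T%:R + 1.
Proof.
move=> T0; pose l : R := ln T%:R.
have H1 : hyperbola_sum T <=
    \sum_(1 <= a < T.+1) (a%:R^-1 + a%:R^-1 * (l - ln a%:R)).
  rewrite hyperbola_sumE; apply: ler_sum_nat => a /andP[a0 aT].
  rewrite -[X in _ <= X + _]mulr1 -mulrDr ler_wpM2l//.
  by rewrite (le_trans (harmonic_sum_le _))// lerD2l ln_divn_le// a0.
apply: (le_trans H1); rewrite big_split/=.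
have := harmonic_sum_le T; rewrite -/(harmonic_sum T) -/l => hT.
have H2 : \sum_(1 <= a < T.+1) a%:R^-1 * (l - ln a%:R) <= l + l ^+ 2 / 2.
  rewrite big_ltn// invr1 mul1r ln1 subr0 lerD2l big_add1/=.
  (* An antiderivative of [(l - ln x) / x], which decreases on [1, T]: the term at [c + 1] is at
     most the increment from [c] to [c + 1]. *)
  pose f c : R := - ((l - ln c%:R) ^+ 2 / 2).
  apply: (@le_trans _ _ (\sum_(1 <= c < T) (f c.+1 - f c))); last first.
    by rewrite telescope_sumr// /f subrr ln1 subr0; lra.
  apply: ler_sum_nat => c /andP[c0 cT].
  have := ln_succ_ge c0; have := ler_ln_nat (ltn0Sn c) cT.
  rewrite /f -/l; move: (ln c%:R) (ln c.+1%:R) => x y xl.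
  have : 0 <= c.+1%:R^-1 :> R by rewrite invr_ge0.
  move: (c.+1%:R^-1) => z z0 zxy.
  have := mulr_ge0 (_ : 0 <= l - y) (_ : 0 <= (y - x) - z).
  have := sqr_ge0 (y - x).
  by move=> h1 /(_ ltac:(lra) ltac:(lra)) h2; nra.
by rewrite -/l; lra.
Qed.

Lemma hyperbola_sum_ge T : (0 < T)%N ->
  ln T%:R ^+ 2 / 2 - 1 / 2 <= hyperbola_sum T.
Proof.
move=> T0; pose l : R := ln T%:R.
have H1 : \sum_(1 <= a < T.+1) (a%:R^-1 * (l - ln a%:R)) <= hyperbola_sum T.
  rewrite hyperbola_sumE; apply: ler_sum_nat => a /andP[a0 aT].
  rewrite ler_wpM2l//.
  by rewrite (le_trans _ (harmonic_sum_ge _))// ln_divn_ge// a0.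
apply: (le_trans _ H1).
pose f c : R := - ((l - ln c%:R) ^+ 2 / 2).
apply: (@le_trans _ _ (\sum_(1 <= c < T.+1) (f c.+1 - f c))).
  rewrite telescope_sumr// /f ln1 subr0 -/l.
  (* The telescoped sum ends at [T + 1], where [ln (T + 1) - ln T <= 1 / T <= 1]; half its square is
     the loss 1/2. *)
  have T1 : T%:R^-1 <= 1 :> R by rewrite invf_le1 ?ltr0n ?ler1n.
  have := ln_succ_le T0; have := ler_ln_nat T0 (leqnSn T); rewrite -/l; nra.
apply: ler_sum_nat => c /andP[c0 cT].
have := ln_succ_le c0; have := ler_ln_nat c0 cT.
rewrite /f -/l; move: (ln c%:R) (ln c.+1%:R) => x y xl.
move: (c%:R^-1) => z zxy.
have := mulr_ge0 (_ : 0 <= l - x) (_ : 0 <= z - (y - x)).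
have := sqr_ge0 (y - x).
by move=> h1 /(_ ltac:(lra) ltac:(lra)) h2; nra.
Qed.

End HarmonicSums.

(** * Moments and tail of the product of two consecutive digits *)

Section Moments.
Variable R : realType.
Implicit Types (t s : R) (N T a b i m n : nat) (w : seq nat).

Lemma sum_hyperbola N T (g : nat -> nat -> R) : (T <= N)%N ->
  \sum_(1 <= a < N.+1) \sum_(1 <= b < N.+1)
    (if (a * b <= T)%N then g a b else 0) =
  \sum_(1 <= a < T.+1) \sum_(1 <= b < (T %/ a).+1) g a b.
Proof.
move=> TN.
have E a : (0 < a)%N ->
    \sum_(1 <= b < N.+1) (if (a * b <= T)%N then g a b else 0) =
    \sum_(1 <= b < (T %/ a).+1) g a b.
  move=> a0; rewrite [RHS](big_nat_widen _ _ N.+1).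
    rewrite -big_mkcond/=; apply: eq_bigl => b.
    by rewrite ltnS leq_divRL// mulnC.
  by rewrite ltnS (leq_trans (leq_div _ _)).
rewrite (@big_cat_nat _ _ _ T.+1)//= [X in _ + X]big_nat [X in _ + X]big1.
  by rewrite addr0; apply: eq_big_nat => a /andP[a0 _]; exact: E.
move=> a /andP[aT _]; rewrite E; last by lia.
by rewrite divn_small// big_geq.
Qed.

(** For [s = 1 / (a + t)] one has [1 + s = (a + 1 + t) / (a + t)], which cancels a factor of the
    first denominator and leaves [(1 + t) / ((a + t)^2 (b + s) (b + 1 + s))]. *)
Lemma pair_prob_le a b t : (0 < a)%N -> (0 < b)%N -> unit_itv t ->
  digit_prob a t * digit_prob b (a%:R + t)^-1 <= (1 + t) * (a%:R * b%:R) ^- 2.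
Proof.
move=> a0 b0 ut; have := unit_itv_inv a0 ut; move: ut => /andP[t0 t1].
have a1 : 1 <= a%:R :> R by rewrite ler1n.
have b1 : 1 <= b%:R :> R by rewrite ler1n.
set s := (a%:R + t)^-1 => /andP[s0 s1].
have -> : digit_prob a t * digit_prob b s =
    (1 + t) * ((a%:R + t) ^+ 2 * ((b%:R + s) * (b%:R + 1 + s)))^-1.
  rewrite /digit_prob (_ : 1 + s = (a%:R + 1 + t) / (a%:R + t)).
    by field; repeat (apply/andP; split); apply: lt0r_neq0; lra.
  by rewrite /s; field; apply: lt0r_neq0; lra.
rewrite ler_wpM2l//; first lra.
rewrite lef_pV2 ?posrE ?exprn_gt0 ?mulr_gt0 ?exprn_gt0//; try lra.
by rewrite exprMn ler_pM ?exprn_ge0//; nra.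
Qed.

Lemma pair_prob_ge a b t : (0 < a)%N -> (0 < b)%N -> unit_itv t ->
  (1 + t) * ((a%:R + 2) * (b%:R + 2)) ^- 2 <=
  digit_prob a t * digit_prob b (a%:R + t)^-1.
Proof.
move=> a0 b0 ut; have := unit_itv_inv a0 ut; move: ut => /andP[t0 t1].
have a1 : 1 <= a%:R :> R by rewrite ler1n.
have b1 : 1 <= b%:R :> R by rewrite ler1n.
set s := (a%:R + t)^-1 => /andP[s0 s1].
have -> : digit_prob a t * digit_prob b s =
    (1 + t) * ((a%:R + t) ^+ 2 * ((b%:R + s) * (b%:R + 1 + s)))^-1.
  rewrite /digit_prob (_ : 1 + s = (a%:R + 1 + t) / (a%:R + t)).
    by field; repeat (apply/andP; split); apply: lt0r_neq0; lra.
  by rewrite /s; field; apply: lt0r_neq0; lra.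
rewrite ler_wpM2l//; first lra.
rewrite lef_pV2 ?posrE ?exprn_gt0 ?mulr_gt0 ?exprn_gt0//; try lra.
by rewrite exprMn ler_pM ?exprn_ge0 ?mulr_ge0//; nra.
Qed.

(** Stated for a general [f] because it serves for the truncated product, for its square, and for
    the indicator of a product above [T]. *)
Definition pair_fun (f : nat -> nat -> R) i w : R :=
  f (nth 0%N w i) (nth 0%N w i.+1).

Definition trunc_prod T a b : R := if (a * b <= T)%N then (a * b)%N%:R else 0.

Lemma expect_pair N t f : expect N 2 t (pair_fun f 0) =
  \sum_(1 <= a < N.+1) \sum_(1 <= b < N.+1)
    digit_prob a t * digit_prob b (a%:R + t)^-1 * f a b.
Proof.
rewrite /=; apply: eq_bigr => a _; rewrite big_distrr/=.
by apply: eq_bigr => b _; rewrite mulrA.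
Qed.

Lemma trunc_prod_ge0 T a b : 0 <= trunc_prod T a b.
Proof. by rewrite /trunc_prod; case: ifP. Qed.

Lemma expect_trunc_le N T t : (T <= N)%N -> unit_itv t ->
  expect N 2 t (pair_fun (trunc_prod T) 0) <= (1 + t) * hyperbola_sum R T.
Proof.
move=> TN ut; rewrite expect_pair /hyperbola_sum -(@sum_hyperbola N)//.
rewrite big_distrr/=; apply: ler_sum_nat => a /andP[a0 _].
rewrite big_distrr/=; apply: ler_sum_nat => b /andP[b0 _].
rewrite /trunc_prod; case: ifP => ab; last by rewrite !mulr0.
rewrite (le_trans (ler_wpM2r _ (pair_prob_le a0 b0 ut)))//.
have ab0 : a%:R * b%:R != 0 :> R by rewrite mulf_neq0// pnatr_eq0 -lt0n.
by rewrite natrM -mulrA expr2 invfM mulfVK.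
Qed.

(** Replacing [(x + 2)^-2] by [x^-2] costs a factor at least [1 - 4 / x], so a pair loses at most
    [4 / a + 4 / b] of its weight [1 / (a b)]. Each loss sums to at most 4 times 2, a bound for the
    sum of inverse squares, times a harmonic sum; 16 = 8 + 8. *)
Lemma expect_trunc_ge N T t : (T <= N)%N -> unit_itv t ->
  (1 + t) * (hyperbola_sum R T - 16 * (1 + ln T%:R)) <=
  expect N 2 t (pair_fun (trunc_prod T) 0).
Proof.
move=> TN ut; rewrite expect_pair.
pose g a b : R :=
  (a%:R * b%:R)^-1 - 4 * a%:R ^- 2 * b%:R^-1 - 4 * a%:R^-1 * b%:R ^- 2.
have -> : \sum_(1 <= a < N.+1) \sum_(1 <= b < N.+1)
    digit_prob a t * digit_prob b (a%:R + t)^-1 * trunc_prod T a b =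
  \sum_(1 <= a < T.+1) \sum_(1 <= b < (T %/ a).+1)
    digit_prob a t * digit_prob b (a%:R + t)^-1 * (a * b)%N%:R.
  rewrite -(@sum_hyperbola N)//; apply: eq_bigr => a _; apply: eq_bigr => b _.
  by rewrite /trunc_prod; case: ifP => _ //; rewrite mulr0.
apply: (@le_trans _ _ (\sum_(1 <= a < T.+1) \sum_(1 <= b < (T %/ a).+1)
    (1 + t) * g a b)); last first.
  apply: ler_sum_nat => a /andP[a0 _]; apply: ler_sum_nat => b /andP[b0 _].
  rewrite (le_trans _ (ler_wpM2r _ (pair_prob_ge a0 b0 ut)))//.
  have a1 : 1 <= a%:R :> R by rewrite ler1n.
  have b1 : 1 <= b%:R :> R by rewrite ler1n.
  rewrite -mulrA ler_wpM2l//; first by case/andP: ut; lra.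
  have K (x : R) : 1 <= x -> 1 - 4 / x <= x ^+ 2 / (x + 2) ^+ 2.
    move=> x1; rewrite ler_pdivlMr ?exprn_gt0//; last lra.
    have -> : (1 - 4 / x) * (x + 2) ^+ 2 = x ^+ 2 - 12 - 16 / x.
      by field; apply: lt0r_neq0; lra.
    have : 0 <= 16 / x by rewrite divr_ge0; lra.
    lra.
  have Ka := K _ a1; have Kb := K _ b1.
  have P (x : R) : 1 <= x -> 0 <= x ^+ 2 / (x + 2) ^+ 2 <= 1.
    move=> x1; rewrite divr_ge0 ?exprn_ge0//=; try lra.
    by rewrite ler_pdivrMr ?exprn_gt0 ?mul1r ?ler_sqr ?nnegrE; lra.
  have /andP[Pa Pa'] := P _ a1; have /andP[Pb Pb'] := P _ b1.
  have -> : ((a%:R + 2) * (b%:R + 2)) ^- 2 * (a * b)%N%:R =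
      (a%:R * b%:R)^-1 * (a%:R ^+ 2 / (a%:R + 2) ^+ 2 *
      (b%:R ^+ 2 / (b%:R + 2) ^+ 2)) :> R.
    by rewrite natrM; field; repeat (apply/andP; split); apply: lt0r_neq0; lra.
  have -> : g a b = (a%:R * b%:R)^-1 * (1 - 4 / a%:R - 4 / b%:R).
    by rewrite /g; field; repeat (apply/andP; split); apply: lt0r_neq0; lra.
  rewrite ler_wpM2l// ?invr_ge0 ?mulr_ge0//.
  move: Ka Kb Pa Pa' Pb Pb'.
  move: (4 / a%:R) (4 / b%:R) (_ / (a%:R + 2) ^+ 2) (_ / (b%:R + 2) ^+ 2).
  move=> u v x y *; nra.
have -> : \sum_(1 <= a < T.+1) \sum_(1 <= b < (T %/ a).+1) (1 + t) * g a b =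
    (1 + t) * \sum_(1 <= a < T.+1) \sum_(1 <= b < (T %/ a).+1) g a b.
  by rewrite big_distrr/=; apply: eq_bigr => a _; rewrite big_distrr.
rewrite ler_wpM2l//; first by case/andP: ut; lra.
rewrite /g; under eq_bigr do rewrite !sumrB.
rewrite !sumrB -/(hyperbola_sum R T).
have hle m : (m <= T)%N -> harmonic_sum R m <= 1 + ln T%:R.
  move=> mT; apply: (le_trans (harmonic_sum_le R m)); rewrite lerD2l.
  by case: m mT => [|m] mT; [rewrite ln0// ln_nat_ge0|exact: ler_ln_nat].
have L0 : 0 <= ln T%:R :> R by exact: ln_nat_ge0.
have S1 : \sum_(1 <= a < T.+1) \sum_(1 <= b < (T %/ a).+1)
    4 * a%:R ^- 2 * b%:R^-1 <= 8 * (1 + ln T%:R) :> R.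
  apply: (@le_trans _ _ (\sum_(1 <= a < T.+1) a%:R ^- 2 * (4 * (1 + ln T%:R)))).
    apply: ler_sum_nat => a /andP[a0 _]; rewrite -big_distrr/=.
    rewrite [4 * _]mulrC -mulrA ler_wpM2l ?invr_ge0 ?exprn_ge0//.
    by rewrite ler_wpM2l// hle// leq_div.
  rewrite -big_distrl/=.
  apply: (le_trans (ler_wpM2r _ (sum_inv_sqr_le R T))); lra.
have S2 : \sum_(1 <= a < T.+1) \sum_(1 <= b < (T %/ a).+1)
    4 * a%:R^-1 * b%:R ^- 2 <= 8 * (1 + ln T%:R) :> R.
  apply: (@le_trans _ _ (\sum_(1 <= a < T.+1) a%:R^-1 * 8)).
    apply: ler_sum_nat => a /andP[a0 _]; rewrite -big_distrr/=.
    rewrite [4 * _]mulrC -mulrA ler_wpM2l ?invr_ge0//.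
    have := sum_inv_sqr_le R (T %/ a); lra.
  by rewrite -big_distrl/= mulrC ler_wpM2l// hle.
lra.
Qed.

(** The squared value cancels the probability, so each pair with [a b <= T] contributes at most
    [1 + t <= 2], and there are at most [T (1 + ln T)] such pairs. *)
Lemma expect_trunc_sqr_le N T t : (T <= N)%N -> unit_itv t ->
  expect N 2 t (pair_fun (fun a b => trunc_prod T a b ^+ 2) 0) <=
  2 * T%:R * (1 + ln T%:R).
Proof.
move=> TN ut; rewrite expect_pair.
apply: (@le_trans _ _ (\sum_(1 <= a < T.+1) \sum_(1 <= b < (T %/ a).+1) 2)).
  rewrite -(@sum_hyperbola N)//; apply: ler_sum_nat => a /andP[a0 _].
  apply: ler_sum_nat => b /andP[b0 _].
  rewrite /trunc_prod; case: ifP => ab; last by rewrite expr0n mulr0.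
  rewrite (le_trans (ler_wpM2r _ (pair_prob_le a0 b0 ut))) ?exprn_ge0//.
  have ab0 : 0 < a%:R * b%:R :> R by rewrite mulr_gt0 ?ltr0n.
  rewrite natrM mulfVK ?expf_neq0 ?lt0r_neq0//.
  by case/andP: ut; lra.
apply: (@le_trans _ _ (\sum_(1 <= a < T.+1) a%:R^-1 * (2 * T%:R))).
  apply: ler_sum_nat => a /andP[a0 _].
  rewrite sumr_const_nat subSS subn0 -(mulr_natr _ (T %/ a)).
  rewrite [leRHS]mulrC -[leRHS]mulrA ler_wpM2l//.
  by rewrite ler_pdivlMr ?ltr0n// -natrM ler_nat leq_divM.
rewrite -big_distrl/= mulrC ler_wpM2l ?mulr_ge0//.
exact: harmonic_sum_le.
Qed.

(** A digit [a <= T] has weight at most [2 / a^2] and is followed by some [b > T / a] with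
    probability at most [2 a / T], which sums to [4 (1 + ln T) / T]; the digits [a > T] add
    [2 / T]. *)
Lemma expect_large_le N T t : (0 < T <= N)%N -> unit_itv t ->
  expect N 2 t (pair_fun (fun a b => (T < a * b)%N%:R) 0) <=
  6 * (1 + ln T%:R) / T%:R.
Proof.
move=> /andP[T0 TN] ut; rewrite expect_pair.
have T1 : 1 <= T%:R :> R by rewrite ler1n.
have ut' : 0 <= t /\ t <= 1 by case/andP: ut.
have inner a : (0 < a)%N -> \sum_(1 <= b < N.+1)
    digit_prob a t * digit_prob b (a%:R + t)^-1 * (T < a * b)%N%:R <=
    digit_prob a t * (2 / (T %/ a).+1%:R).
  move=> a0; set m := (T %/ a)%N.
  have us := unit_itv_inv a0 ut; set s := _^-1 in us *.
  under eq_bigr do rewrite -mulrA.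
  rewrite -big_distrr/= ler_wpM2l ?digit_prob_ge0//.
  have mN : (m <= N)%N by rewrite (leq_trans (leq_div _ _)).
  apply: (@le_trans _ _ (1 - digit_cdf m s)).
    rewrite (@big_cat_nat _ _ _ m.+1)//= big_nat big1 ?add0r; last first.
      move=> b /andP[_ bm]; rewrite ltnNge mulnC -leq_divRL// -ltnS bm.
      by rewrite mulr0.
    apply: (@le_trans _ _ (\sum_(m.+1 <= b < N.+1) digit_prob b s)).
      apply: ler_sum => b _; rewrite ler_piMr ?digit_prob_ge0//.
      by case: (T < _)%N.
    by rewrite sum_digit_prob// lerD2r digit_cdf_le1.
  case/andP: us => s0 s1; have m0 : 0 <= m%:R :> R by [].
  rewrite /digit_cdf -natr1 (_ : 1 - _ = (1 + s) / (m%:R + 1 + s)).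
    by rewrite ler_pM ?invr_ge0//; [lra|lra|lra|rewrite lef_pV2 ?posrE; lra].
  by field; apply: lt0r_neq0; lra.
rewrite (@big_cat_nat _ _ _ T.+1)//=.
have A : \sum_(1 <= a < T.+1) \sum_(1 <= b < N.+1)
    digit_prob a t * digit_prob b (a%:R + t)^-1 * (T < a * b)%N%:R <=
    4 * (1 + ln T%:R) / T%:R.
  apply: (@le_trans _ _ (\sum_(1 <= a < T.+1) a%:R^-1 * (4 / T%:R))).
    apply: ler_sum_nat => a /andP[a0 aT]; apply: (le_trans (inner _ a0)).
    have a1 : 1 <= a%:R :> R by rewrite ler1n.
    have Ta : T%:R <= a%:R * (T %/ a).+1%:R :> R.
      by rewrite -natrM ler_nat mulnC ltnW// ltn_ceil.
    have P : digit_prob a t <= 2 * a%:R ^- 2.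
      rewrite /digit_prob ler_pM ?invr_ge0 ?mulr_ge0//; try lra.
      by rewrite lef_pV2 ?posrE ?exprn_gt0 ?mulr_gt0//; [nra|lra..].
    have Q : 2 / (T %/ a).+1%:R <= 2 * a%:R / T%:R :> R.
      rewrite ler_pdivrMr ?ltr0n// mulrAC ler_pdivlMr; lra.
    apply: (le_trans (ler_pM _ _ P Q)); rewrite ?digit_prob_ge0 ?divr_ge0//.
    rewrite le_eqVlt; apply/orP; left; apply/eqP.
    by field; repeat (apply/andP; split); apply: lt0r_neq0; lra.
  rewrite -big_distrl/= mulrC mulrAC ler_wpM2r ?invr_ge0//.
  by rewrite ler_wpM2l// harmonic_sum_le.
have B : \sum_(T.+1 <= a < N.+1) \sum_(1 <= b < N.+1)
    digit_prob a t * digit_prob b (a%:R + t)^-1 * (T < a * b)%N%:R <= 2 / T%:R.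
  apply: (@le_trans _ _ (\sum_(T.+1 <= a < N.+1) digit_prob a t)).
    apply: ler_sum_nat => a /andP[aT _].
    have a0 : (0 < a)%N by apply: leq_trans aT.
    under eq_bigr do rewrite -mulrA; rewrite -big_distrr/=.
    rewrite ler_piMr ?digit_prob_ge0//.
    rewrite (le_trans _ (sum_digit_prob_le1 N (unit_itv_inv a0 ut)))//.
    apply: ler_sum => b _; rewrite ler_piMr ?digit_prob_ge0//.
      exact: unit_itv_inv.
    by case: (T < _)%N.
  rewrite sum_digit_prob// (@le_trans _ _ (1 - digit_cdf T t))//.
    by rewrite lerD2r digit_cdf_le1.
  rewrite /digit_cdf (_ : 1 - _ = (1 + t) / (T%:R + 1 + t)).
    by rewrite ler_pM ?invr_ge0//; [lra|lra|lra|rewrite lef_pV2 ?posrE; lra].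
  by field; apply: lt0r_neq0; lra.
apply: (le_trans (lerD A B)).
have L0 : 0 <= ln T%:R :> R by exact: ln_nat_ge0.
by rewrite -mulrDl ler_wpM2r ?invr_ge0//; lra.
Qed.

End Moments.

(** * Second moment of the truncated sum *)

Section PairSums.
Variable R : realType.
Variables (N : nat) (f : nat -> nat -> R).
Hypothesis N2 : (2 <= N)%N.
Hypothesis f_ge0 : forall a b, 0 <= f a b.
Implicit Types (t s c h : R) (i j k m n : nat) (w : seq nat) (G : seq nat -> R).

Local Notation X := (pair_fun f).
Let EX t := expect N 2 t (X 0).

Lemma pair_fun_ge0 i w : 0 <= X i w. Proof. exact: f_ge0. Qed.

Lemma expect_pair_ge0 t : unit_itv t -> 0 <= EX t.
Proof. by move=> ut; apply: expect_ge0 => // w; exact: pair_fun_ge0. Qed.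

Lemma expect_pair_mul k t G : expect N k.+2 t (fun w => X 0 w * G (drop 2 w)) =
  \sum_(1 <= a < N.+1) \sum_(1 <= b < N.+1)
    digit_prob a t * digit_prob b (a%:R + t)^-1 * f a b *
    expect N k (b%:R + (a%:R + t)^-1)^-1 G.
Proof.
rewrite /=; apply: eq_bigr => a _; rewrite big_distrr/=.
apply: eq_bigr => b _; rewrite -[RHS]mulrA -[RHS]mulrA.
congr (_ * (_ * _)); rewrite -expectZ.
by apply: eq_expect => w _; rewrite drop0.
Qed.

Lemma pair_weight_ge0 a b t : (0 < a)%N -> unit_itv t ->
  0 <= digit_prob a t * digit_prob b (a%:R + t)^-1 * f a b.
Proof.
move=> a0 ut; apply: mulr_ge0; last exact: f_ge0.
by apply: mulr_ge0; apply: digit_prob_ge0 => //; exact: unit_itv_inv.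
Qed.

(** Given the first two digits, the rest starts from some ratio in [0, 1], so a bound uniform in the
    ratio factors out. This takes the place of independence. *)
Lemma expect_pair_mul_le k t c G : unit_itv t ->
  (forall s, unit_itv s -> expect N k s G <= c) ->
  expect N k.+2 t (fun w => X 0 w * G (drop 2 w)) <= c * EX t.
Proof.
move=> ut Gc; rewrite expect_pair_mul /EX expect_pair big_distrr/=.
apply: ler_sum_nat => a /andP[a0 _]; rewrite big_distrr/=.
apply: ler_sum_nat => b /andP[b0 _]; have us := unit_itv_inv a0 ut.
by rewrite [leRHS]mulrC ler_wpM2l ?Gc ?pair_weight_ge0 ?unit_itv_inv//.
Qed.

Lemma expect_pair_mul_ge k t c G : unit_itv t ->
  (forall s, unit_itv s -> c <= expect N k s G) ->
  c * EX t <= expect N k.+2 t (fun w => X 0 w * G (drop 2 w)).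
Proof.
move=> ut Gc; rewrite expect_pair_mul /EX expect_pair big_distrr/=.
apply: ler_sum_nat => a /andP[a0 _]; rewrite big_distrr/=.
apply: ler_sum_nat => b /andP[b0 _]; have us := unit_itv_inv a0 ut.
by rewrite mulrC ler_wpM2l ?Gc ?pair_weight_ge0 ?unit_itv_inv//.
Qed.

Lemma expect_pair_extend_le k t : unit_itv t -> expect N k.+2 t (X 0) <= EX t.
Proof.
move=> ut; rewrite -[leRHS]mul1r.
rewrite (@eq_expect _ N _ t _ (fun w => X 0 w * 1)); last first.
  by move=> w; rewrite mulr1.
apply: (@expect_pair_mul_le k t 1 (fun=> 1)) => // s us.
exact: expect_le_cst.
Qed.

Lemma expect_pair_extend_ge k t : unit_itv t ->
  (1 - 2 * k%:R / N%:R) * EX t <= expect N k.+2 t (X 0).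
Proof.
move=> ut.
rewrite (@eq_expect _ N k.+2 t _ (fun w => X 0 w * 1)); last first.
  by move=> w; rewrite mulr1.
apply: (@expect_pair_mul_ge k t _ (fun=> 1)) => // s us.
rewrite expect_cst -[leLHS]mul1r.
by apply: iter_transfer_ge_cst.
Qed.

Lemma expect_pair_shift i k t : expect N (i + k.+2) t (X i) =
  iter i (transfer N) (fun s => expect N k.+2 s (X 0)) t.
Proof.
rewrite -expect_drop; apply: eq_expect => w _.
by rewrite /pair_fun !nth_drop addn0 addn1.
Qed.

Lemma iter_transfer_late_le i K t h : (K <= i)%N -> unit_itv t -> 0 <= h ->
  (forall s, unit_itv s -> iter K (transfer N) EX s <= h) ->
  iter i (transfer N) EX t <= h.
Proof.
by move=> Ki ut h0 Hh; rewrite -(subnK Ki) iterD iter_transfer_le_cst.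
Qed.

Lemma expect_pair_le i m t h : (i.+2 <= m)%N -> unit_itv t -> 0 <= h ->
  (forall s, unit_itv s -> EX s <= h) -> expect N m t (X i) <= h.
Proof.
move=> im ut h0 Hh; have -> : m = (i + (m - i.+2).+2)%N by lia.
rewrite expect_pair_shift; apply: iter_transfer_le_cst => // s us.
by rewrite (le_trans (expect_pair_extend_le _ us)) ?Hh.
Qed.

Lemma expect_pair_late_le i m K t h : (i.+2 <= m)%N -> (K <= i)%N ->
  unit_itv t -> 0 <= h ->
  (forall s, unit_itv s -> iter K (transfer N) EX s <= h) ->
  expect N m t (X i) <= h.
Proof.
move=> im Ki ut h0 Hh; have -> : m = (i + (m - i.+2).+2)%N by lia.
rewrite expect_pair_shift (le_trans _ (iter_transfer_late_le Ki ut h0 Hh))//.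
by apply: le_iter_transfer => // s us; exact: expect_pair_extend_le.
Qed.

(** The mass lost to digits above [N] is charged twice, for the digits after the pair and for the
    first [i - K] digits; hence the square. *)
Lemma expect_pair_late_ge i m K t h : (i.+2 <= m)%N -> (K <= i)%N ->
  (2 * m <= N)%N -> unit_itv t -> 0 <= h ->
  (forall s, unit_itv s -> h <= iter K (transfer N) EX s) ->
  h * (1 - 2 * m%:R / N%:R) ^+ 2 <= expect N m t (X i).
Proof.
move=> im Ki mN ut h0 Hh; have mE : m = (i + (m - i.+2).+2)%N by lia.
have N0 : 2 <= N%:R :> R by rewrite ler_nat.
have le k : (k <= m)%N -> 1 - 2 * m%:R / N%:R <= 1 - 2 * k%:R / N%:R :> R.
  move=> km; rewrite lerD2l lerN2 ler_wpM2r ?invr_ge0//.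
  by rewrite ler_wpM2l// ler_nat.
have d0 : 0 <= 1 - 2 * m%:R / N%:R :> R.
  by rewrite subr_ge0 ler_pdivrMr ?mul1r -?natrM ?ler_nat//; lra.
set d := 1 - 2 * m%:R / N%:R in le d0 *.
rewrite {1}mE expect_pair_shift.
apply: (@le_trans _ _ (iter i (transfer N) (fun s => d * EX s) t)); last first.
  apply: le_iter_transfer => // s us.
  rewrite (le_trans _ (expect_pair_extend_ge _ us))// ler_wpM2r//.
    exact: expect_pair_ge0.
  by apply: le; lia.
rewrite iter_transferZ expr2 mulrCA ler_wpM2l// -(subnK Ki) iterD.
rewrite (le_trans _ (iter_transfer_ge_cst (i - K) ut h0 N2 Hh))// ler_wpM2l//.
by apply: le; lia.
Qed.

(** At least [K] digits lie between the two pairs, so the conditional mean of [X j] is at most [h]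
    whatever the first pair was; [K <= i] then yields the second factor [h]. *)
Lemma expect_pair_cross_le i j m K t h : (i + K + 2 <= j)%N -> (j.+2 <= m)%N ->
  (K <= i)%N -> unit_itv t -> 0 <= h ->
  (forall s, unit_itv s -> iter K (transfer N) EX s <= h) ->
  expect N m t (fun w => X i w * X j w) <= h ^+ 2.
Proof.
move=> ij jm Ki ut h0 Hh; have mE : m = (i + (m - i.+2).+2)%N by lia.
pose G v := X 0 v * X (j - i.+2) (drop 2 v).
rewrite mE (@eq_expect _ N _ t _ (fun w => G (drop i w))); last first.
  move=> w _; rewrite /G /pair_fun !nth_drop !addn0 addn1; congr (_ * f _ _).
    by congr nth; lia.
  by congr nth; lia.
rewrite expect_drop.
apply: (@le_trans _ _ (iter i (transfer N) (fun s => h * EX s) t)).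
  apply: le_iter_transfer => // s us; apply: expect_pair_mul_le => // r ur.
  by apply: (@expect_pair_late_le _ _ K) => //; lia.
by rewrite iter_transferZ expr2 ler_wpM2l// (iter_transfer_late_le Ki).
Qed.

End PairSums.

(** * Mean and second moment of the sum over consecutive pairs *)

Section Chebyshev.
Variable R : realType.
Implicit Types (t s c h : R) (N i j k m n : nat) (w : seq nat).
Variables (N : nat) (f : nat -> nat -> R).
Hypothesis N2 : (2 <= N)%N.
Hypothesis f_ge0 : forall a b, 0 <= f a b.
Local Notation X := (pair_fun f).

Definition pair_sum n w : R := \sum_(0 <= i < n) X i w.

Lemma sum_window_le n i k :
  \sum_(0 <= j < n) ((i <= j) && (j < i + k))%N%:R <= k%:R :> R.
Proof.
rewrite -natr_sum ler_nat.
suff -> : (\sum_(0 <= j < n) ((i <= j) && (j < i + k)) =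
    minn n (i + k) - minn n i)%N by lia.
elim: n => [|n IH]; first by rewrite big_geq; lia.
by rewrite big_nat_recr//= IH; lia.
Qed.

(** Four windows of length [K + 2] mark the pairs with [i] or [j] near 0 or with [i], [j] close on
    either side; there [x y <= (x^2 + y^2) / 2] gives the crude bound [c], and elsewhere the bound
    is [h^2]. The word must have more than [n] digits because [X (n - 1)] reads entry [n]. *)
Lemma expect_pair_sum_sqr_le n m K t h c : (n < m)%N -> unit_itv t ->
  0 <= h -> 0 <= c ->
  (forall s, unit_itv s ->
     iter K (transfer N) (fun s => expect N 2 s (X 0)) s <= h) ->
  (forall s, unit_itv s ->
     expect N 2 s (pair_fun (fun a b => f a b ^+ 2) 0) <= c) ->
  expect N m t (fun w => pair_sum n w ^+ 2) <=
  n%:R ^+ 2 * h ^+ 2 + 4 * n%:R * K.+2%:R * c.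
Proof.
move=> nm ut h0 c0 Hh Hc.
rewrite (@eq_expect _ N m t _ (fun w =>
  \sum_(0 <= i < n) \sum_(0 <= j < n) X i w * X j w)); last first.
  move=> w _; rewrite expr2 /pair_sum mulr_suml.
  by apply: eq_bigr => i _; rewrite mulr_sumr.
rewrite expect_sum; under eq_bigr do rewrite expect_sum.
pose win i j k : R := ((i <= j) && (j < i + k))%N%:R.
have win0 i j k : 0 <= win i j k by [].
pose bnd i j := h ^+ 2 +
  c * (win 0%N i K.+2 + win 0%N j K.+2 + win i j K.+2 + win j i K.+2).
have sq i : (i < n)%N -> expect N m t (fun w => X i w ^+ 2) <= c.
  move=> i_n; have f2 a b : 0 <= f a b ^+ 2 by exact: sqr_ge0.
  by apply: (expect_pair_le N2 f2) => //; lia.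
have crude i j : (i < n)%N -> (j < n)%N ->
    expect N m t (fun w => X i w * X j w) <= c.
  move=> i_n j_n; apply: (@le_trans _ _
    (expect N m t (fun w => 2^-1 * (X i w ^+ 2 + X j w ^+ 2)))).
    by apply: le_expect => // w; have := sqr_ge0 (X i w - X j w); lra.
  by rewrite expectZ expectD; have := sq _ i_n; have := sq _ j_n; lra.
have B i j : (i < n)%N -> (j < n)%N ->
    expect N m t (fun w => X i w * X j w) <= bnd i j.
  move=> i_n j_n.
  have far k l : (k < n)%N -> (l < n)%N -> (K <= k)%N -> (k + K + 2 <= l)%N ->
      expect N m t (fun w => X k w * X l w) <= bnd i j.
    move=> kn ln Kk kl; apply: (@le_trans _ _ (h ^+ 2)).
      by apply: (@expect_pair_cross_le _ N f N2 f_ge0 k l m K t h) => //; lia.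
    by rewrite /bnd lerDl mulr_ge0// !addr_ge0.
  have close (b : R) : 1 <= b ->
      expect N m t (fun w => X i w * X j w) <= h ^+ 2 + c * b.
    move=> b1; rewrite (le_trans (crude _ _ i_n j_n))//.
    by rewrite ler_wpDl ?sqr_ge0// ler_peMr.
  have := win0 0%N i K.+2; have := win0 0%N j K.+2.
  have := win0 i j K.+2; have := win0 j i K.+2 => p1 p2 p3 p4.
  have [iK|Ki] := ltnP i K.+2.
    apply: close; have -> : win 0%N i K.+2 = 1 by rewrite /win /= add0n iK.
    lra.
  have [jK|Kj] := ltnP j K.+2.
    apply: close; have -> : win 0%N j K.+2 = 1 by rewrite /win /= add0n jK.
    lra.
  have [ij|ji] := leqP i j.
    have [w1|w1] := ltnP j (i + K.+2).
      apply: close; have -> : win i j K.+2 = 1 by rewrite /win ij w1.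
      lra.
    by apply: far => //; lia.
  have [w1|w1] := ltnP i (j + K.+2).
    apply: close; have -> : win j i K.+2 = 1 by rewrite /win (ltnW ji) w1.
    lra.
  rewrite (@eq_expect _ N m t _ (fun w => X j w * X i w)); last first.
    by move=> w _; rewrite mulrC.
  by apply: far => //; lia.
apply: (@le_trans _ _ (\sum_(0 <= i < n) \sum_(0 <= j < n) bnd i j)).
  apply: ler_sum_nat => i /andP[_ i_n]; apply: ler_sum_nat => j /andP[_ j_n].
  exact: B.
have W : \sum_(0 <= i < n) \sum_(0 <= j < n)
    (win 0%N i K.+2 + win 0%N j K.+2 + win i j K.+2 + win j i K.+2) <=
    4 * n%:R * K.+2%:R.
  have S k : \sum_(0 <= i < n) (k%:R : R) = n%:R * k%:R.
    by rewrite sumr_const_nat subn0 mulr_natl.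
  under eq_bigr do rewrite !big_split/=.
  rewrite !big_split/=.
  have s1 : \sum_(0 <= i < n) \sum_(0 <= j < n) win 0%N j K.+2 <=
      n%:R * K.+2%:R.
    by rewrite -S; apply: ler_sum => i _; exact: sum_window_le.
  have s2 : \sum_(0 <= i < n) \sum_(0 <= j < n) win 0%N i K.+2 <=
      n%:R * K.+2%:R.
    by rewrite exchange_big/=.
  have s3 : \sum_(0 <= i < n) \sum_(0 <= j < n) win i j K.+2 <= n%:R * K.+2%:R.
    by rewrite -S; apply: ler_sum => i _; exact: sum_window_le.
  have s4 : \sum_(0 <= i < n) \sum_(0 <= j < n) win j i K.+2 <= n%:R * K.+2%:R.
    by rewrite exchange_big/=.
  lra.
rewrite /bnd; under eq_bigr do rewrite big_split/=.
rewrite big_split/= lerD//.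
  rewrite !sumr_const_nat !subn0 -mulrnA -(mulr_natr _ (n * n)) natrM -expr2.
  by rewrite mulrC.
under eq_bigr do rewrite -mulr_sumr.
by rewrite -mulr_sumr mulrC ler_wpM2r.
Qed.

(** The first [K] terms, too early for the lower bound [h], are dropped by nonnegativity. *)
Lemma expect_pair_sum_ge n m K t h : (n < m)%N -> (2 * m <= N)%N ->
  unit_itv t -> 0 <= h ->
  (forall s, unit_itv s ->
     h <= iter K (transfer N) (fun s => expect N 2 s (X 0)) s) ->
  (n - K)%:R * (h * (1 - 2 * m%:R / N%:R) ^+ 2) <=
  expect N m t (pair_sum n).
Proof.
move=> nm mN ut h0 Hh; rewrite /pair_sum expect_sum.
have [Kn|nK] := leqP K n; last first.
  rewrite (_ : (n - K)%N = 0%N) ?mul0r; last by lia.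
  by rewrite sumr_ge0// => i _; apply: expect_ge0 => // w; exact: f_ge0.
rewrite (@big_cat_nat _ _ _ K)//= ler_wpDl//.
  by rewrite sumr_ge0// => i _; apply: expect_ge0 => // w; exact: f_ge0.
rewrite mulr_natl -sumr_const_nat; apply: ler_sum_nat => i /andP[Ki i_n].
by apply: (@expect_pair_late_ge _ N f N2 f_ge0 i m K t h) => //; lia.
Qed.

End Chebyshev.

(** * Chebyshev's inequality for the set of large deviations *)

Section BadSet.
Variable R : realType.
Local Notation mu := (@lebesgue_measure R).

Lemma bad_set_le (n K N T : nat) (A d h h' : R) :
  (2 * n.+1 <= N)%N -> (0 < T <= N)%N -> 0 < d -> 0 <= A -> 0 <= h -> 0 <= h' ->
  (forall s : R, unit_itv s -> h' <= iter K (transfer N)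
    (fun s => expect N 2 s (pair_fun (trunc_prod R T) 0)) s <= h) ->
  (mu [set x : R | [/\ irrational x, (0 < x < 1)%R &
      (d <= `|(product_sum n x)%:R - A|)%R ]] <=
   (n%:R * (6 * (1 + ln T%:R) / T%:R) +
    (n%:R ^+ 2 * h ^+ 2 + 4 * n%:R * K.+2%:R * (2 * T%:R * (1 + ln T%:R))
     - 2 * A * ((n - K)%:R * (h' * (1 - 2 * n.+1%:R / N%:R) ^+ 2)) + A ^+ 2)
      / d ^+ 2 + n.+1%:R * (2 / N%:R))%:E)%E.
Proof.
move=> nN /andP[T0 TN] d0 A0 h0 h'0 Hh.
have N2 : (2 <= N)%N by lia.
have u0 : unit_itv (0 : R) by rewrite /unit_itv lexx ler01.
have lnT := @ln_nat_ge0 R T.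
pose large a b : R := (T < a * b)%N%:R.
(* At least 1 on the whole bad set: either some product exceeds [T] and the count is at least 1, or
   the truncated sum is the true one and its squared deviation is at least [d^2]. A single
   expectation thus contains both the union bound and Chebyshev's inequality. *)
pose G w := pair_sum large n w + d ^- 2 *
  (pair_sum (trunc_prod R T) n w - A) ^+ 2.
have D0 w : 0 <= d ^- 2 * (pair_sum (trunc_prod R T) n w - A) ^+ 2.
  by apply: mulr_ge0; [rewrite invr_ge0 sqr_ge0|exact: sqr_ge0].
have G0 w : 0 <= G w by rewrite addr_ge0// sumr_ge0.
apply: (@le_trans _ _ (mu [set x : R | [/\ irrational x, (0 < x < 1)%R &
    (1 <= G (digits n.+1 x))%R]])).
  apply: le_lebesgue => x [ix x01 dx]; split=> //.
  set w := digits n.+1 x.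
  have pE : product_sum n x = (\sum_(0 <= i < n) nth 0 w i * nth 0 w i.+1)%N.
    rewrite /product_sum big_add1/=; apply: eq_big_nat => i /andP[_ i_n].
    have nE k : (k < n.+1)%N -> partial_quotient x k.+1 = nth 0%N w k.
      by move=> kn; rewrite -(nth_digits x kn).
    by rewrite !nE//; lia.
  have d20 : 0 < d ^+ 2 by rewrite exprn_gt0.
  have [/hasP[i]|/hasPn H] := boolP (has
      (fun i => T < nth 0%N w i * nth 0%N w i.+1)%N (iota 0 n)).
    rewrite mem_iota/= add0n => i_n Ti.
    rewrite /G ler_wpDr//.
    rewrite /pair_sum big_mkord (bigD1 (Ordinal i_n))//=.
    by rewrite {1}/pair_fun /large Ti lerDl sumr_ge0.
  rewrite /G; have -> : pair_sum (trunc_prod R T) n w = (product_sum n x)%:R.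
    rewrite pE natr_sum; apply: eq_big_nat => i /andP[_ i_n].
    have := H i; rewrite mem_iota/= add0n i_n => /(_ isT).
    by rewrite -leqNgt /pair_fun /trunc_prod => ->.
  rewrite ler_wpDl ?sumr_ge0// mulrC ler_pdivlMr// mul1r.
  by rewrite -[leRHS]real_normK ?num_real// ler_sqr ?nnegrE ?(ltW d0).
have N0 : (0 < N)%N by lia.
apply: (le_trans (lebesgue_digits_le n.+1 N0 G0)).
rewrite lee_fin lerD2r /G expectD expectZ lerD//.
  rewrite /pair_sum expect_sum mulr_natl -[X in _ *+ X](subn0 n).
  rewrite -sumr_const_nat.
  apply: ler_sum_nat => i /andP[_ i_n].
  apply: expect_pair_le => //; first by rewrite divr_ge0// mulr_ge0//; lra.
  by move=> s us; apply: expect_large_le => //; rewrite T0.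
rewrite [leRHS]mulrC ler_wpM2l ?invr_ge0 ?sqr_ge0//.
set S := pair_sum (trunc_prod R T) n.
rewrite (@eq_expect _ N _ 0 _
  (fun w => S w ^+ 2 + ((- 2 * A) * S w + A ^+ 2 * 1))); last first.
  by move=> w _; ring.
rewrite !expectD !expectZ.
have E1 := @expect_pair_sum_sqr_le _ N _ N2 (@trunc_prod_ge0 R T) n n.+1 K 0 h
  (2 * T%:R * (1 + ln T%:R)) (leqnn _) u0 h0.
have E2 := @expect_pair_sum_ge _ N _ N2 (@trunc_prod_ge0 R T) n n.+1 K 0 h'
  (leqnn _) nN u0 h'0.
have {}E1 : expect N n.+1 0 (fun w => S w ^+ 2) <= n%:R ^+ 2 * h ^+ 2 +
   4 * n%:R * K.+2%:R * (2 * T%:R * (1 + ln T%:R)).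
  apply: E1; first by rewrite !mulr_ge0//; lra.
    by move=> s us; case/andP: (Hh s us).
  by move=> s us; exact: expect_trunc_sqr_le.
have {}E2 : (n - K)%:R * (h' * (1 - 2 * n.+1%:R / N%:R) ^+ 2) <=
    expect N n.+1 0 S.
  by apply: E2 => s us; case/andP: (Hh s us).
have E3 : expect N n.+1 0 (fun=> 1) <= 1 :> R by exact: expect_le_cst.
have := ler_wpM2l A0 E2; have := ler_wpM2l (sqr_ge0 A) E3; lra.
Qed.

End BadSet.

(** * Asymptotics *)

Section Asymptotics.
Variable R : realType.
Local Notation mu := (@lebesgue_measure R).
Implicit Types (e y eps : R) (n K N T : nat).

(** Apply [ln u < u] to [u = (e / 2) y]; the constant [- ln (e / 2)] is absorbed by the other half
    of [e y]. *)
Lemma ln_small e : 0 < e ->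
  exists Y : R, forall y, Y <= y -> 0 < y -> ln y <= e * y.
Proof.
move=> e0; pose s := e / 2; have s0 : 0 < s by rewrite divr_gt0.
exists (- ln s / s) => y Yy y0.
have sy : 0 < s * y by rewrite mulr_gt0.
have := ln_sublinear sy; rewrite lnM ?posrE//.
move: Yy; rewrite ler_pdivrMr// => Yy; rewrite /s in Yy *; lra.
Qed.

(** The number [K] of steps is fixed before [N], since the truncation error grows with [K]. Two
    errors [e / 4] become [e] after division by [ln 2 >= 1 / 2]. *)
Lemma iter_transfer_near e : 0 < e -> exists K : nat, exists M : R,
  forall N, (2 <= N)%N -> M <= N%:R -> forall s : R, unit_itv s ->
  (ln 2)^-1 - e <= iter K (transfer N) (fun t => 1 + t) s <= (ln 2)^-1 + e.
Proof.
move=> e0.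
have [K K_e] : exists K : nat, 3 * (9 / 10) ^+ K <= e / 4 :> R.
  have : (9 / 10 : R) ^+ k @[k --> \oo] --> 0.
    by apply: cvg_expr; rewrite ger0_norm; lra.
  have e12 : 0 < e / 12 by rewrite divr_gt0.
  move=> /cvgrPdist_le/(_ _ e12)[k _ /(_ k (leqnn k))].
  have k0 : 0 <= (9 / 10) ^+ k :> R by apply: exprn_ge0; lra.
  by rewrite sub0r normrN ger0_norm// => ke; exists k; lra.
exists K, ((62 + 2 * K%:R) / (e / 4)) => N N2 MN s us.
have N0 : 2 <= N%:R :> R by rewrite ler_nat.
have NK : (62 + 2 * K%:R) / N%:R <= e / 4.
  rewrite ler_pdivrMr; last lra.
  by move: MN; rewrite ler_pdivrMr ?divr_gt0// [leRHS]mulrC.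
have := iter_transfer_cvg K N2 us.
set W := iter _ _ _ _ => H.
have {H} : `|ln 2 * W - 1| <= e / 2.
  by have := lerD K_e NK; move: H; move: (3 * _ + _) => u; lra.
have l2 := ln2_ge R; have l0 : 0 < ln 2 :> R by lra.
have -> : ln 2 * W - 1 = ln 2 * (W - (ln 2)^-1).
  by rewrite mulrBr divff// lt0r_neq0.
rewrite ler_norml => /andP[w1 w2].
apply/andP; split; nra.
Qed.

Lemma truncation_level e K : 0 < e <= 1 -> exists Y : R, forall n,
  Y <= ln n%:R ->
  let y : R := ln n%:R in
  exists T : nat, [/\ (0 < T)%N,
    hyperbola_sum R T <= y ^+ 2 * (1 / 2 + e),
    y ^+ 2 * (1 / 2 - e) <= hyperbola_sum R T - 16 * (1 + ln T%:R),
    4 * n%:R * K.+2%:R * (2 * T%:R * (1 + ln T%:R)) <=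
      e * (n%:R * y ^+ 2) ^+ 2 &
    n%:R * (6 * (1 + ln T%:R) / T%:R) <= e].
Proof.
move=> /andP[e0 e1].
have [Y1 lnY] := @ln_small (e / 6) ltac:(by rewrite divr_gt0).
have k2 : 2 <= K.+2%:R :> R by rewrite ler_nat.
(* The last two claims have a factor [y] to spare and reduce to [24 (K + 2) <= e y] and [72 <= e y];
   the same bound absorbs the terms linear in [y] of the hyperbola estimates. *)
pose Y2 := 100 * K.+2%:R / e.
exists (Num.max Y1 Y2) => n; rewrite ge_max => /andP[yY1 yY2] y.
rewrite -/y in yY1 yY2.
have ey : 100 * K.+2%:R <= e * y.
  by move: yY2; rewrite ler_pdivrMr// [leRHS]mulrC.
have y100 : 200 <= y by nra.
have n0 : (0 < n)%N.
  by case: n @y {yY1 yY2 ey} y100 => // y; rewrite /y ln0//; lra.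
have n1 : 1 <= n%:R :> R by rewrite ler1n.
pose L := Num.truncn y.
have /andP[Ly yL] : L%:R <= y < L.+1%:R by apply: truncn_itv; lra.
rewrite -natr1 in yL.
(* Rounding [y] down to [L] keeps [T] between [n y^2 / 4] and [n y^2]. *)
pose T := (n * L ^ 2)%N.
have L0 : (0 < L)%N by rewrite -(ltr_nat R); lra.
have T0 : (0 < T)%N by rewrite muln_gt0 n0 expn_gt0 L0.
have TE : T%:R = n%:R * L%:R ^+ 2 :> R by rewrite natrM natrX.
have lnTE : ln T%:R = y + 2 * ln L%:R :> R.
  rewrite TE lnM ?posrE ?exprn_gt0 ?ltr0n// lnXn ?ltr0n//.
  by rewrite mulr_natl.
have lnL : ln L%:R <= e / 6 * y :> R.
  rewrite (le_trans _ (lnY y yY1 _))//; last lra.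
  by rewrite ler_ln ?posrE ?ltr0n//; lra.
have lnL0 : 0 <= ln L%:R :> R by exact: ln_nat_ge0.
have lnT : ln T%:R <= y + e / 3 * y by rewrite lnTE; lra.
have lnT2 : 1 + ln T%:R <= 3 * y by nra.
have lnTy : y <= ln T%:R by rewrite lnTE; lra.
exists T; split=> //.
- apply: (le_trans (hyperbola_sum_le R T0)); nra.
- have := hyperbola_sum_ge R T0; nra.
- have Ty : T%:R <= n%:R * y ^+ 2.
    by rewrite TE ler_wpM2l ?ler_sqr ?nnegrE//; lra.
  apply: (@le_trans _ _ (4 * n%:R * K.+2%:R * (2 * (n%:R * y ^+ 2) * (3 * y)))).
    rewrite ler_wpM2l ?mulr_ge0//.
    have T1 : 0 <= T%:R :> R by [].
    by apply: ler_pM; lra.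
  have -> : 4 * n%:R * K.+2%:R * (2 * (n%:R * y ^+ 2) * (3 * y)) =
    (n%:R * y) ^+ 2 * (24 * K.+2%:R * y) by ring.
  have -> : e * (n%:R * y ^+ 2) ^+ 2 = (n%:R * y) ^+ 2 * (e * y * y) by ring.
  rewrite ler_wpM2l ?sqr_ge0//; nra.
- have Ty : n%:R * (y ^+ 2 / 4) <= T%:R.
    by rewrite TE ler_wpM2l//; nra.
  rewrite mulrA ler_pdivrMr ?ltr0n//.
  apply: (@le_trans _ _ (e * (n%:R * (y ^+ 2 / 4)))); last first.
    by rewrite ler_wpM2l// ltW.
  have -> : e * (n%:R * (y ^+ 2 / 4)) = n%:R * (e * y ^+ 2 / 4) by ring.
  rewrite ler_wpM2l//; nra.
Qed.

(** At [e = 0] the left side is [c^2 / 4 - c^2 / 2 + c^2 / 4 = 0], so the error is linear in [e]: 7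
    from the second moment, 1 from the near pairs, and [6 c <= 12] from the mean. *)
Lemma deviation_le c e : 1 <= c <= 2 -> 0 < e <= 1 / 10 ->
  (1 / 2 + e) ^+ 2 * (c + e) ^+ 2 + e
    - c * ((1 - e) * ((1 / 2 - e) * (c - e) * (1 - e) ^+ 2)) + (c / 2) ^+ 2 <=
  20 * e :> R.
Proof.
move=> /andP[c1 c2] /andP[e0 e1].
have U : ((1 / 2 + e) * (c + e)) ^+ 2 <= (c / 2) ^+ 2 + 7 * e.
  have h : (1 / 2 + e) * (c + e) <= c / 2 + 3 * e by nra.
  have h0 : 0 <= (1 / 2 + e) * (c + e) by rewrite mulr_ge0; lra.
  have : ((1 / 2 + e) * (c + e)) ^+ 2 <= (c / 2 + 3 * e) ^+ 2.
    by rewrite ler_sqr ?nnegrE; lra.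
  nra.
have V : c / 2 - 3 * e <= (1 / 2 - e) * (c - e) by nra.
have W : 1 - 3 * e <= (1 - e) ^+ 3 by rewrite !exprS expr0; nra.
have V0 : 0 <= c / 2 - 3 * e by lra.
have W0 : 0 <= 1 - 3 * e by lra.
have P := ler_pM W0 V0 W V.
have Q : c / 2 - 6 * e <= (1 - 3 * e) * (c / 2 - 3 * e) by nra.
have c0 : 0 <= c by lra.
have := ler_wpM2l c0 (le_trans Q P).
rewrite exprMn in U; rewrite !exprS !expr0 in U *; nra.
Qed.

(** Here [z] is [n (ln n)^2] and [c] is [1 / ln 2]; [p], [q], [r] are the costs of products above
    [T], of near pairs and of digits above [N], and [m] bounds the mean from below. *)
Lemma assemble_deviation z c e eps (p q r m : R) : 0 < z -> 0 < eps ->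
  1 <= c <= 2 -> 0 < e <= 1 / 10 -> p <= e -> q <= e * z ^+ 2 -> r <= e ->
  z * ((1 - e) * ((1 / 2 - e) * (c - e) * (1 - e) ^+ 2)) <= m ->
  p + (z ^+ 2 * ((1 / 2 + e) ^+ 2 * (c + e) ^+ 2) + q - 2 * (z * (c / 2)) * m
    + (z * (c / 2)) ^+ 2) / (eps * z) ^+ 2 + r <= 2 * e + 20 * e / eps ^+ 2.
Proof.
move=> z0 eps0 c12 e01 pe qe re zm.
have B := deviation_le c12 e01.
have z20 : 0 <= z ^+ 2 by exact: sqr_ge0.
have {}B := ler_wpM2l z20 B.
have zc : 0 <= 2 * (z * (c / 2)).
  by case/andP: c12 => c1 _; rewrite mulr_ge0// mulr_ge0 ?ltW// divr_gt0//; lra.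
have {}zm := ler_wpM2l zc zm.
have V : z ^+ 2 * ((1 / 2 + e) ^+ 2 * (c + e) ^+ 2) + q - 2 * (z * (c / 2)) * m
    + (z * (c / 2)) ^+ 2 <= 20 * e / eps ^+ 2 * (eps * z) ^+ 2.
  have -> : 20 * e / eps ^+ 2 * (eps * z) ^+ 2 = z ^+ 2 * (20 * e).
    by field; rewrite lt0r_neq0.
  apply: le_trans B.
  set u := (1 / 2 - e) * (c - e) * (1 - e) ^+ 2 in zm *.
  set v := (1 / 2 + e) ^+ 2 * (c + e) ^+ 2.
  clearbody u v; clear -zm qe; lra.
rewrite -ler_pdivrMr ?exprn_gt0 ?mulr_gt0// in V.
clear -V pe re; lra.
Qed.

Lemma bad_set_small e eps : 0 < eps -> 0 < e <= 1 / 10 ->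
  exists Y : R, forall n, Y <= ln n%:R ->
  (mu [set x : R | [/\ irrational x, (0 < x < 1)%R &
      (eps <= `| (product_sum n x)%:R / (n%:R * ln n%:R ^+ 2)
                - 1 / (2 * ln 2) |)%R ]] <=
   (2 * e + 20 * e / eps ^+ 2)%:E)%E.
Proof.
move=> eps0 e01; have /andP[e0 e1] := e01.
have [K [M KM]] := iter_transfer_near e0.
have [Y HY] := @truncation_level e K ltac:(apply/andP; split; lra).
(* [K / e] ensures [K <= e ln n <= e n], so that dropping [K] terms costs at most the fraction [e];
   the bound 1 excludes [n = 0], where [ln] takes the value 0. *)
exists (Num.max Y (Num.max 1 (K%:R / e))) => n.
rewrite !ge_max => /and3P[/HY/= [T [T0 D1 D2 D3 D4]] y1].
move: D1 D2 D3 D4 y1; set y : R := ln n%:R => D1 D2 D3 D4 y1.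
rewrite ler_pdivrMr// => yK.
have n0 : (0 < n)%N.
  by case: n @y y1 {D1 D2 D3 D4 yK} => // y; rewrite /y ln0//; lra.
have n1 : 1 <= n%:R :> R by rewrite ler1n.
have ny : y <= n%:R by rewrite ltW// ln_sublinear; lra.
(* [N] comes after [n] and [T]: it must exceed the threshold [M] for the iterates, and
   [2 (n + 1) / e] to keep the total truncation loss below [e]. *)
have [N [Nn NT MN eN]] : exists N, [/\ (2 * n.+1 <= N)%N, (T <= N)%N,
    (Num.truncn M).+1%:R <= N%:R :> R &
    (Num.truncn (2 * n.+1%:R / e)).+1%:R <= N%:R :> R].
  exists (maxn (maxn (2 * n.+1) T)
    (maxn (Num.truncn M).+1 (Num.truncn (2 * n.+1%:R / e)).+1)).
  by rewrite !ler_nat !leq_max !leqnn !orbT.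
have NM : M <= N%:R.
  have [M0|/ltW M0] := leP 0 M; last exact: le_trans M0 _.
  by have /andP[_ /ltW h] := truncn_itv M0; exact: le_trans h MN.
have N2 : (2 <= N)%N by apply: leq_trans Nn; rewrite leq_pmulr.
have N0 : 2 <= N%:R :> R by rewrite ler_nat.
have Ne : 2 * n.+1%:R / N%:R <= e.
  have p0 : 0 <= 2 * n.+1%:R / e by rewrite divr_ge0// ltW.
  rewrite ler_pdivrMr; last lra.
  rewrite [leRHS]mulrC -ler_pdivrMr//.
  by have /andP[_ /ltW h] := truncn_itv p0; exact: le_trans h eN.
set c := (ln 2)^-1 : R.
have l0 : 0 < ln 2 :> R by have := ln2_ge R; lra.
have c1 : 1 <= c by rewrite /c invf_ge1 ?ln2_le1.
have c2 : c <= 2.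
  by rewrite /c -div1r ler_pdivrMr//; have := ln2_ge R; lra.
have y20 : 0 < y ^+ 2 by rewrite exprn_gt0//; lra.
pose A := n%:R * y ^+ 2 * (c / 2); pose d := eps * (n%:R * y ^+ 2).
pose h := y ^+ 2 * (1 / 2 + e) * (c + e).
pose h' := y ^+ 2 * (1 / 2 - e) * (c - e).
have z0 : 0 < n%:R * y ^+ 2 by rewrite mulr_gt0//; lra.
have Hh (s : R) : unit_itv s -> h' <= iter K (transfer N)
    (fun s => expect N 2 s (pair_fun (trunc_prod R T) 0)) s <= h.
  move=> us; have /andP[W1 W2] := KM N N2 NM s us.
  have D0 : 0 <= hyperbola_sum R T.
    by rewrite /hyperbola_sum sumr_ge0// => a _; rewrite sumr_ge0.
  apply/andP; split.
    apply: (@le_trans _ _ (iter K (transfer N) (fun t =>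
        (hyperbola_sum R T - 16 * (1 + ln T%:R)) * (1 + t)) s)); last first.
      by apply: le_iter_transfer => // t ut; rewrite mulrC expect_trunc_ge.
    rewrite iter_transferZ /h' ler_pM//; [|lra].
    by rewrite mulr_ge0 ?ltW//; lra.
  apply: (@le_trans _ _ (iter K (transfer N) (fun t =>
      hyperbola_sum R T * (1 + t)) s)).
    by apply: le_iter_transfer => // t ut; rewrite mulrC expect_trunc_le.
  rewrite iter_transferZ /h ler_pM//.
  by apply: iter_transfer_ge0 => // t /andP[t0 t1]; lra.
have h0 : 0 <= h.
  by clear -y20 c1 e0; apply: mulr_ge0; [apply: mulr_ge0|]; lra.
have h'0 : 0 <= h'.
  by clear -y20 c1 e0 e1; apply: mulr_ge0; [apply: mulr_ge0|]; lra.
have A0 : 0 <= A by clear -z0 c1; apply: mulr_ge0; lra.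
have d0 : 0 < d by rewrite mulr_gt0.
apply: (@le_trans _ _ (mu [set x : R | [/\ irrational x, (0 < x < 1)%R &
      (d <= `|(product_sum n x)%:R - A|)%R ]])).
  apply: le_lebesgue => x [ix x01 Hx]; split=> //.
  have -> : (product_sum n x)%:R - A = n%:R * y ^+ 2 *
      ((product_sum n x)%:R / (n%:R * y ^+ 2) - 1 / (2 * ln 2)).
    rewrite mulrBr [X in _ = X - _]mulrC divfK ?lt0r_neq0//; congr (_ - _).
    by rewrite /A /c; field; rewrite lt0r_neq0.
  by rewrite normrM gtr0_norm// /d mulrC ler_wpM2l// ltW.
have TN : (0 < T <= N)%N by rewrite T0.
apply: (le_trans (bad_set_le Nn TN d0 A0 h0 h'0 Hh)).
rewrite lee_fin.
have -> : n%:R ^+ 2 * h ^+ 2 =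
    (n%:R * y ^+ 2) ^+ 2 * ((1 / 2 + e) ^+ 2 * (c + e) ^+ 2).
  by rewrite /h; ring.
have -> : n.+1%:R * (2 / N%:R) = 2 * n.+1%:R / N%:R :> R by ring.
apply: assemble_deviation => //; first by rewrite c1.
have nK : n%:R * (1 - e) <= (n - K)%:R.
  have yne := ler_wpM2r (ltW e0) ny.
  have : n%:R <= (n - K)%:R + K%:R :> R.
    by rewrite -natrD ler_nat addnC -leq_subLR.
  clear -yne yK; lra.
have Q1 : (1 - e) ^+ 2 <= (1 - 2 * n.+1%:R / N%:R) ^+ 2.
  by clear -Ne e0 e1; rewrite ler_sqr ?nnegrE; lra.
have -> : n%:R * y ^+ 2 * ((1 - e) * ((1 / 2 - e) * (c - e) * (1 - e) ^+ 2)) =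
    n%:R * (1 - e) * (h' * (1 - e) ^+ 2) by rewrite /h'; ring.
have e1' : 0 <= 1 - e by clear -e1; lra.
apply: ler_pM nK _; [exact: mulr_ge0| |exact: ler_wpM2l].
by apply: mulr_ge0 => //; exact: sqr_ge0.
Qed.

End Asymptotics.

Theorem theorem1p4 (R : realType) (eps : R) (eps_gt0 : 0 < eps) :
  lebesgue_measure
    [set x : R | [/\ irrational x, 0 < x < 1 &
      eps <= `| (product_sum n x)%:R / (n%:R * ln n%:R ^+ 2)
                - 1 / (2 * ln 2) | ]]
    @[n --> \oo] --> (0 : \bar R)%E.
Proof.
have small (eta : R) : 0 < eta -> \forall n \near \oo,
    (lebesgue_measure [set x : R | [/\ irrational x, (0 < x < 1)%R &
      (eps <= `| (product_sum n x)%:R / (n%:R * ln n%:R ^+ 2)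
                - 1 / (2 * ln 2) |)%R ]] <= eta%:E)%E.
  move=> eta0.
  have den0 : 0 < 2 + 20 / eps ^+ 2 by rewrite ltr_pwDl// divr_ge0// sqr_ge0.
  (* The bound of [bad_set_small] is [e (2 + 20 / eps^2)], made at most [eta]; the cap 1/10 is its
     hypothesis on [e]. *)
  pose e := Num.min (1 / 10) (eta / (2 + 20 / eps ^+ 2)).
  have e0 : 0 < e by rewrite lt_min !divr_gt0.
  have e1 : e <= 1 / 10 by rewrite ge_min lexx.
  have [Y HY] := @bad_set_small R e eps eps_gt0 ltac:(by rewrite e0 e1).
  near=> n.
  apply: (le_trans (HY n _)).
    rewrite -[Y]expRK ler_ln ?posrE ?expR_gt0//; last first.
      by rewrite (lt_le_trans (expR_gt0 Y))//; near: n; exact: nbhs_infty_ger.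
    by near: n; exact: nbhs_infty_ger.
  rewrite lee_fin (_ : 2 * e + _ = e * (2 + 20 / eps ^+ 2)); last by ring.
  by rewrite -ler_pdivlMr// ge_min lexx orbT.
apply/fine_cvgP; split.
  near=> n; rewrite ge0_fin_numE//.
  apply: (@le_lt_trans _ _ 1%:E); last exact: ltry.
  by near: n; exact: small.
apply/cvgrPdist_le => eta eta0; near=> n.
rewrite sub0r normrN ger0_norm ?fine_ge0//=.
have h : (lebesgue_measure [set x : R | [/\ irrational x, (0 < x < 1)%R &
      (eps <= `| (product_sum n x)%:R / (n%:R * ln n%:R ^+ 2)
                - 1 / (2 * ln 2) |)%R ]] <= eta%:E)%E.
  by near: n; exact: small.
rewrite -lee_fin fineK// ge0_fin_numE//.
by apply: le_lt_trans h _; exact: ltry.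
Unshelve. all: by end_near. Qed.
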